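(* Each of the classes of n-slender groups, of cm-slender groups, and of lcH-slender groups is closed under taking graph products: if $\Gamma$ is a simple graph with vertex set $V$ and $\{G_v\}_{v\in V}$ are groups all belonging to one of these classes, then the graph product $\Gamma(V,\{G_v\}_{v\in V})$ belongs to that class. In particular, each of these classes is closed under (arbitrary) free products and direct sums.
   Context: Given a simple graph $\Gamma$ with vertex set $V$ and groups $G_v$ ($v\in V$), the graph product $\Gamma(V,\{G_v\}_{v\in V})$ is the quotient of the free product $*_{v\in V}G_v$ by the normal subgroup generated by all commutators $[g,h]$ with $g\in G_u$, $h\in G_v$ and $u,v$ adjacent in $\Gamma$. (The free product corresponds to the graph with no edges, the direct sum to the complete graph.) Let $E=\bigcup_{n\in\mathbb{N}}C((0,\tfrac1n),\tfrac1n)\subseteq\mathbb{R}^2$ be the Hawaiian earring and $\mathbb{H}=\pi_1(E,(0,0))$. For $N\in\mathbb{N}$ let $p_N:\mathbb{H}\to\mathbb{H}$ be induced by the retraction of $E$ onto the union of the first $N$ circles collapsing the other circles to the base point. A group $G$ is n-slender if for every homomorphism $\phi:\mathbb{H}\to G$ there is $N$ with $\phi=\phi\circ p_N$. A group is cm-slender if every homomorphism to it from a completely metrizable topological group has open kernel, and lcH-slender if every homomorphism to it from a locally compact Hausdorff topological group has open kernel. *)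

(* Defs.v *)
From HB Require Import structures.
From mathcomp Require Import all_boot all_order all_algebra.
From mathcomp Require Import all_classical all_reals all_analysis.
From mathcomp Require Import Rstruct Rstruct_topology.
Set Implicit Arguments. Unset Strict Implicit. Unset Printing Implicit Defensive.
Import Order.TTheory GRing.Theory Num.Theory.
Local Open Scope classical_set_scope.
Local Open Scope ring_scope.

Notation R := Rdefinitions.R.

Record group := Group {
  gcar :> Type;
  gmul : gcar -> gcar -> gcar;
  ginv : gcar -> gcar;
  gone : gcar;
  gmulA : forall x y z, gmul x (gmul y z) = gmul (gmul x y) z;
  gmul1 : forall x, gmul gone x = x;
  gmulV : forall x, gmul (ginv x) x = gone }.

Definition is_hom (G H : group) (f : G -> H) : Prop :=
  forall x y, f (gmul x y) = gmul (f x) (f y).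

Definition simple_graph (V : Type) (adj : V -> V -> Prop) : Prop :=
  (forall u v, adj u v -> adj v u) /\ (forall v, ~ adj v v).

Definition adj_commute (V : Type) (adj : V -> V -> Prop) (Gv : V -> group)
  (K : group) (f : forall v, Gv v -> K) : Prop :=
  forall u v, adj u v -> forall (g : Gv u) (h : Gv v),
    gmul (f u g) (f v h) = gmul (f v h) (f u g).

(* (P, iota) is the graph product Gamma(V, {G_v}): the quotient of the free
   product of the G_v by the commutators [G_u, G_v], u ~ v, characterised
   (up to unique isomorphism) by its universal property. *)
Definition is_graph_product (V : Type) (adj : V -> V -> Prop) (Gv : V -> group)
  (P : group) (iota : forall v, Gv v -> P) : Prop :=
  (forall v, is_hom (iota v)) /\ adj_commute adj iota /\
  forall (K : group) (f : forall v, Gv v -> K),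
    (forall v, is_hom (f v)) -> adj_commute adj f ->
    (exists F : P -> K, is_hom F /\ forall v (g : Gv v), F (iota v g) = f v g) /\
    (forall F1 F2 : P -> K, is_hom F1 -> is_hom F2 ->
       (forall v (g : Gv v), F1 (iota v g) = F2 (iota v g)) ->
       forall x, F1 x = F2 x).

Record topgroup := TopGroup {
  tg_space : topologicalType;
  tg_mul : tg_space -> tg_space -> tg_space;
  tg_inv : tg_space -> tg_space;
  tg_one : tg_space;
  tg_mulA : forall x y z, tg_mul x (tg_mul y z) = tg_mul (tg_mul x y) z;
  tg_mul1 : forall x, tg_mul tg_one x = x;
  tg_mulV : forall x, tg_mul (tg_inv x) x = tg_one;
  tg_mul_cont : continuous (fun p : tg_space * tg_space => tg_mul p.1 p.2);
  tg_inv_cont : continuous tg_inv }.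

Definition is_thom (T : topgroup) (G : group) (f : tg_space T -> G) : Prop :=
  forall x y, f (tg_mul x y) = gmul (f x) (f y).

Definition completely_metrizable (T : topologicalType) : Prop :=
  exists d : T -> T -> R,
    (forall x y, 0 <= d x y) /\ (forall x y, d x y = 0 <-> x = y) /\
    (forall x y, d x y = d y x) /\ (forall x y z, d x z <= d x y + d y z) /\
    (forall A : set T, open A <->
       forall x, A x -> exists2 e : R, 0 < e & [set y | d x y < e] `<=` A) /\
    (forall u : nat -> T,
       (forall e : R, 0 < e -> exists N, forall m n, (N <= m)%N -> (N <= n)%N ->
          d (u m) (u n) < e) ->
       exists x, forall e : R, 0 < e -> exists N, forall n, (N <= n)%N ->
          d x (u n) < e).

Definition locally_compact_hausdorff (T : topologicalType) : Prop :=
  hausdorff_space T /\ locally_compact [set: T].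

Definition cm_slender (G : group) : Prop :=
  forall (T : topgroup), completely_metrizable (tg_space T) ->
  forall f : tg_space T -> G, is_thom f -> open [set x | f x = gone G].

Definition lcH_slender (G : group) : Prop :=
  forall (T : topgroup), locally_compact_hausdorff (tg_space T) ->
  forall f : tg_space T -> G, is_thom f -> open [set x | f x = gone G].

Definition circle (n : nat) : set (R * R) :=
  [set p | p.1 ^+ 2 + (p.2 - (n.+1%:R)^-1) ^+ 2 = (n.+1%:R)^-1 ^+ 2].

Definition earring : set (R * R) := \bigcup_(n in [set: nat]) circle n.

Definition base : R * R := (0, 0).

Definition retr (N : nat) (p : R * R) : R * R :=
  if `[< exists2 n, (n < N)%N & circle n p >] then p else base.

Definition I01 : set R := [set t | 0 <= t <= 1].

Definition is_loop (g : R -> R * R) : Prop :=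
  {within I01, continuous g} /\ (forall t, I01 t -> earring (g t)) /\
  g 0 = base /\ g 1 = base.

Definition loop_homotopic (g h : R -> R * R) : Prop :=
  exists H : R * R -> R * R,
    {within I01 `*` I01, continuous H} /\
    (forall s t, I01 s -> I01 t -> earring (H (s, t))) /\
    (forall t, I01 t -> H (0, t) = g t /\ H (1, t) = h t) /\
    (forall s, I01 s -> H (s, 0) = base /\ H (s, 1) = base).

Definition loop_concat (g h : R -> R * R) (t : R) : R * R :=
  if t <= 2^-1 then g (2 * t) else h (2 * t - 1).

(* A homomorphism pi_1(E,(0,0)) -> G, given on representing loops:
   constant on homotopy classes and multiplicative for concatenation. *)
Definition hawaii_hom (G : group) (phi : (R -> R * R) -> G) : Prop :=
  (forall g h, is_loop g -> is_loop h -> loop_homotopic g h -> phi g = phi h) /\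
  (forall g h, is_loop g -> is_loop h ->
     phi (loop_concat g h) = gmul (phi g) (phi h)).

Definition n_slender (G : group) : Prop :=
  forall phi : (R -> R * R) -> G, hawaii_hom phi ->
  exists N : nat, forall g, is_loop g -> phi g = phi (retr N \o g).

(* Main.v *)
(* Let [K] be the kernel of the projection of the graph product [P] to the product of
   the vertex groups, and let [f] be a homomorphism to [P], say from a topological
   group.  First, [f] maps a neighbourhood of the unit to [K]: otherwise slenderness
   of the vertex groups allows one to choose terms with pairwise disjoint supports
   whose infinite product is mapped to an element of infinite support.  Secondly,
   the word length [L] of [P] satisfies [L (h ^ k) >= max (k, L h)] for non-trivial
   [h] in [K] and positive [k].  If no neighbourhood of the unit were killed, one
   could then solve [y n = x n * (y n.+1) ^ k n] with [f (x n) <> 1] and exponents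
   [k n] so large that the length of [f (y 0)] would have to be infinite (Dudley).
   The infinite words exist by completeness, by compactness, and, for the Hawaiian
   earring, as infinite concatenations of loops in smaller and smaller circles.
   The length inequality is read off from normal forms: for each vertex [v], [P] is
   the amalgam of the subgroup generated by the other vertex groups and of the star
   of [v] over the link of [v]. *)
From Stdlib Require Rtopology.
Require Import Defs.
From mathcomp Require Import all_boot all_order all_algebra.
From mathcomp Require Import all_classical all_reals all_analysis.
From mathcomp Require Import Rstruct Rstruct_topology.
From mathcomp Require Import zify ring lra.
Set Implicit Arguments. Unset Strict Implicit. Unset Printing Implicit Defensive.
Import Order.TTheory GRing.Theory Num.Theory numFieldNormedType.Exports.
Local Open Scope classical_set_scope.

(** Outside [K] the length inequality fails: a letter and all its powers have length at most 1.
    Inside [K] the obstacle is cancellation between consecutive factors of a power. Fix [v]. If the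
    two ends of a normal form of [h] do not cancel cyclically, the number of syllables at [v] grows
    with the exponent ([hyperbolic]). Otherwise [h] is a conjugate of a shorter [y] in [K]
    ([elliptic]). The count at [v] may then stay bounded; by induction on the length it does not
    drop, and growth is found at a vertex where some iterated [y] is hyperbolic. This is why lengths
    are counted vertex by vertex. For the earring, killing the loops in small circles is not yet
    [phi = phi o p_N]: a loop may alternate infinitely often between large and small circles. A
    homotopy that flattens a neighbourhood of the base point on the large circles leaves finitely
    many excursions into them, so that the loop can be cut into finitely many factors. *)

Local Notation "x ** y" := (gmul x y) (at level 40, left associativity).

(** * Groups *)

Section GroupTheory.
Variable G : group.
Implicit Types x y z : G.

Lemma gmulKl x y : ginv x ** (x ** y) = y.
Proof. by rewrite gmulA gmulV gmul1. Qed.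

Lemma gmulVr x : x ** ginv x = gone G.
Proof.
by rewrite -[LHS](gmulKl (ginv x)) [ginv x ** _]gmulA gmulV gmul1 gmulV.
Qed.

Lemma gmulr1 x : x ** gone G = x.
Proof. by rewrite -(gmulV x) gmulA gmulVr gmul1. Qed.

Lemma gmulK x y : x ** y ** ginv y = x.
Proof. by rewrite -gmulA gmulVr gmulr1. Qed.

Lemma gmulVK x y : x ** ginv y ** y = x.
Proof. by rewrite -gmulA gmulV gmulr1. Qed.

Lemma gmulrI x y z : y ** x = z ** x -> y = z.
Proof. by move=> e; rewrite -(gmulK y x) e gmulK. Qed.

Lemma gmulI x y z : x ** y = x ** z -> y = z.
Proof. by move=> e; rewrite -(gmulKl x y) e gmulKl. Qed.

Lemma ginvK x : ginv (ginv x) = x.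
Proof. by apply: (@gmulrI (ginv x)); rewrite gmulV gmulVr. Qed.

Lemma ginvM x y : ginv (x ** y) = ginv y ** ginv x.
Proof. by apply: (@gmulrI (x ** y)); rewrite gmulV gmulA gmulVK gmulV. Qed.

Lemma ginv1 : ginv (gone G) = gone G.
Proof. by rewrite -[LHS]gmulr1 gmulV. Qed.

Lemma ginv_eq1 x : ginv x = gone G -> x = gone G.
Proof. by move=> e; rewrite -(ginvK x) e ginv1. Qed.

Definition gsimp := (gmulA, gmulK, gmulVK, gmul1, gmulr1, gmulV, gmulVr,
                     ginvM, ginvK, ginv1).

Definition gpow x k : G := iter k (gmul x) (gone G).

Lemma gpowS x k : gpow x k.+1 = x ** gpow x k. Proof. by []. Qed.

Lemma gpowD x k l : gpow x (k + l) = gpow x k ** gpow x l.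
Proof. by elim: k => [|k IH]; rewrite ?gmul1 // addSn !gpowS IH gmulA. Qed.

Lemma gpowM x k l : gpow x (k * l) = gpow (gpow x k) l.
Proof. by elim: l => [|l IH]; rewrite ?muln0 // mulnS gpowD IH. Qed.

Lemma gpow_conj p x k : gpow (p ** x ** ginv p) k = p ** gpow x k ** ginv p.
Proof.
by elim: k => [|k IH]; [rewrite /gpow /= !gsimp | rewrite !gpowS IH !gsimp].
Qed.

End GroupTheory.

Section Homs.
Variables (G H : group) (f : G -> H).
Hypothesis fM : is_hom f.

Lemma hom1 : f (gone G) = gone H.
Proof. by apply: (@gmulrI _ (f (gone G))); rewrite -fM !gmul1. Qed.

Lemma homV x : f (ginv x) = ginv (f x).
Proof. by apply: (@gmulrI _ (f x)); rewrite -fM !gmulV hom1. Qed.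

Lemma homX x k : f (gpow x k) = gpow (f x) k.
Proof. by elim: k => [|k IH]; rewrite ?hom1 // !gpowS fM IH. Qed.

End Homs.

Lemma sig_eq (T : Type) (Q : T -> Prop) (u v : {x | Q x}) :
  sval u = sval v -> u = v.
Proof.
case: u v => x Qx [y Qy] /= e; subst y.
by rewrite (Prop_irrelevance Qx Qy).
Qed.

Section Subgroup.
Variables (G : group) (Q : G -> Prop).
Hypotheses (Q1 : Q (gone G)) (QM : forall x y, Q x -> Q y -> Q (x ** y))
  (QV : forall x, Q x -> Q (ginv x)).

Definition subgroup : group.
Proof.
refine (@Defs.Group {x | Q x}
  (fun x y => exist Q _ (QM (svalP x) (svalP y)))
  (fun x => exist Q _ (QV (svalP x))) (exist Q _ Q1) _ _ _).
- by move=> x y z; apply: sig_eq; rewrite /= gmulA.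
- by move=> x; apply: sig_eq; rewrite /= gmul1.
- by move=> x; apply: sig_eq; rewrite /= gmulV.
Defined.

End Subgroup.

Section SymmetricGroup.
Variable T : Type.

Record symm := Symm { sfun :> T -> T; sinv : T -> T;
  sfunK : cancel sfun sinv; sinvK : cancel sinv sfun }.

Lemma symm_eq (f g : symm) : sfun f = sfun g -> f = g.
Proof.
case: f g => f f' fK f'K [g g' gK g'K] /= e; subst g.
have e' : f' = g' by apply/funext => x; rewrite -[RHS]fK g'K.
by subst g'; rewrite (Prop_irrelevance fK gK) (Prop_irrelevance f'K g'K).
Qed.

Definition sym_group : group.
Proof.
refine (@Defs.Group symm
  (fun f g => @Symm (f \o g) (sinv g \o sinv f)
     (can_comp (@sfunK f) (@sfunK g)) (can_comp (@sinvK g) (@sinvK f)))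
  (fun f => @Symm (sinv f) f (@sinvK f) (@sfunK f))
  (@Symm id id (frefl id) (frefl id)) _ _ _).
- by move=> *; apply: symm_eq.
- by move=> *; apply: symm_eq.
- by move=> f; apply: symm_eq; apply/funext => x /=; rewrite sfunK.
Defined.

Variables (G : group) (act : G -> T -> T).
Hypotheses (act1 : forall t, act (gone G) t = t)
  (actM : forall x y t, act (x ** y) t = act x (act y t)).

Definition act_sym (x : G) : sym_group.
Proof.
refine (@Symm (act x) (act (ginv x)) _ _) => t.
- by rewrite -actM gmulV.
- by rewrite -actM gmulVr.
Defined.

Lemma act_sym_hom : is_hom act_sym.
Proof. by move=> x y; apply: symm_eq; apply/funext => t /=; rewrite actM. Qed.

End SymmetricGroup.

Lemma split_first (T : Type) (p : pred T) s : has p s ->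
  exists s1 x s2, [/\ s = s1 ++ x :: s2, p x & ~~ has p s1].
Proof.
elim: s => [//|y s IH] /=; case: (boolP (p y)) => [py _|npy /= /IH].
  by exists [::], y, s.
move=> [s1 [x [s2 [-> px ns]]]]; exists (y :: s1), x, s2; split=> //=.
by rewrite negb_or npy.
Qed.

Lemma split_last (T : Type) (p : pred T) s : has p s ->
  exists s1 x s2, [/\ s = s1 ++ x :: s2, p x & ~~ has p s2].
Proof.
rewrite -has_rev => /split_first[s1 [x [s2 [e px ns]]]].
exists (rev s2), x, (rev s1); rewrite has_rev; split=> //.
by rewrite -(revK s) e rev_cat rev_cons -cats1 -catA.
Qed.

(** * Graph products *)

Section GraphProduct.
Variables (V : Type) (adj : V -> V -> Prop) (Gv : V -> group)
  (P : group) (iota : forall v, Gv v -> P).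
Hypotheses (graphV : simple_graph adj) (prodP : is_graph_product adj iota).

Let iotaM v : is_hom (@iota v). Proof. by case: prodP. Qed.

Let iotaC : adj_commute adj iota. Proof. by case: prodP => _ []. Qed.

Definition letter := {v & Gv v}.

Definition ev (w : seq letter) : P :=
  foldr (fun l x => iota (tagged l) ** x) (gone P) w.

Lemma ev_cat w1 w2 : ev (w1 ++ w2) = ev w1 ** ev w2.
Proof. by elim: w1 => [|l w IH] /=; rewrite ?gmul1 // IH gmulA. Qed.

Lemma ev_cons v (g : Gv v) w : ev (Tagged Gv g :: w) = iota g ** ev w.
Proof. by []. Qed.

Definition parabolic (p : V -> Prop) (x : P) : Prop :=
  exists2 w : seq letter, all (fun l => `[< p (tag l) >]) w & ev w = x.

Section Parabolic.
Variable p : V -> Prop.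

Lemma parabolic1 : parabolic p (gone P).
Proof. by exists [::]. Qed.

Lemma parabolicM x y : parabolic p x -> parabolic p y -> parabolic p (x ** y).
Proof.
move=> [w pw <-] [w' pw' <-]; exists (w ++ w'); last exact: ev_cat.
by rewrite all_cat pw.
Qed.

Lemma parabolic_iota v (g : Gv v) : p v -> parabolic p (iota g).
Proof.
move=> pv; exists [:: Tagged Gv g]; last by rewrite ev_cons gmulr1.
by rewrite /= andbT; apply/asboolP.
Qed.

Lemma parabolicV x : parabolic p x -> parabolic p (ginv x).
Proof.
move=> [w + <-]; elim: w => [_|[v g] w IH /= /andP[/asboolP pv /IH pw]] /=.
  by rewrite ginv1; apply: parabolic1.
rewrite ginvM; apply: parabolicM => //.
by rewrite -(homV (@iotaM v)); apply: parabolic_iota.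
Qed.

Lemma parabolicMl x y : parabolic p x -> parabolic p (x ** y) -> parabolic p y.
Proof.
by move=> /parabolicV px pxy; rewrite -(gmulKl x y); apply: parabolicM.
Qed.

Lemma parabolicMr x y : parabolic p y -> parabolic p (x ** y) -> parabolic p x.
Proof.
by move=> /parabolicV py pxy; rewrite -(gmulK x y); apply: parabolicM.
Qed.

Lemma parabolicX x k : parabolic p x -> parabolic p (gpow x k).
Proof.
by move=> px; elim: k => [|k IH]; [apply: parabolic1 | apply: parabolicM].
Qed.

End Parabolic.

(** [P] maps to its subgroup generated by the letters by existence in the universal property, and
    the composite with the inclusion is the identity by uniqueness. *)
Lemma gen_all x : parabolic (fun=> True) x.
Proof.
pose K := subgroup (parabolic1 _) (@parabolicM _) (@parabolicV (fun=> True)).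
pose f v (g : Gv v) : K := exist _ (iota g) (parabolic_iota g I).
have [_ [_ univ]] := prodP.
have [] := univ K f.
- by move=> v g h; apply: sig_eq; apply: iotaM.
- by move=> u v uv g h; apply: sig_eq; apply: iotaC.
move=> [F [FM Fiota]] _.
have [_ /(_ (fun x => sval (F x)) id) F_id] := prodP.2.2 P iota iotaM iotaC.
have <- : sval (F x) = x.
  by apply: F_id => [y z||v g]; rewrite ?FM ?Fiota.
exact: svalP.
Qed.

Lemma ev_onto x : exists w, ev w = x.
Proof. by have [w _ <-] := gen_all x; exists w. Qed.

Lemma extend_hom (K : group) (f : forall v, Gv v -> K) :
  (forall v, is_hom (f v)) -> adj_commute adj f ->
  exists F : P -> K, is_hom F /\ forall v (g : Gv v), F (iota g) = f v g.
Proof. by move=> fM fC; have [_ [_ univ]] := prodP; case: (univ K f). Qed.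

(** The other vertex groups are sent to 1, so a commutation relation could only fail if both
    adjacent vertices were [v], which irreflexivity excludes. *)
Lemma proj_exists v : exists r : P -> Gv v, [/\ is_hom r,
  forall g, r (iota g) = g &
  forall u (g : Gv u), u <> v -> r (iota g) = gone (Gv v)].
Proof.
pose f u (g : Gv u) : Gv v :=
  if pselect (u = v) is left e then ecast u (Gv u) e g else gone (Gv v).
have [u g h||r [rM riota]] := @extend_hom (Gv v) f.
- by rewrite /f; case: pselect => [e|_]; [subst u | rewrite gmul1].
- move=> u w uw g h; rewrite /f; case: pselect => [e|_]; last by rewrite !gsimp.
  case: pselect => [e'|_]; last by rewrite !gsimp.
  by case: (graphV.2 v); rewrite -{1}e -e'.
exists r; split=> // [g|u g nuv]; rewrite riota /f; case: pselect => // e.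
by rewrite (Prop_irrelevance e erefl).
Qed.

Definition vproj v : P -> Gv v := sval (cid (proj_exists v)).

Lemma projM v : is_hom (@vproj v).
Proof. by rewrite /vproj; case: cid => r []. Qed.

Lemma proj_iota v (g : Gv v) : vproj v (iota g) = g.
Proof. by rewrite /vproj; case: cid => r [] /=. Qed.

Lemma proj_iota_neq u v (g : Gv u) : u <> v -> vproj v (iota g) = gone (Gv v).
Proof. by rewrite /vproj; case: cid => r [] /= _ _; apply. Qed.

Lemma proj_off v x : parabolic (fun u => u <> v) x -> vproj v x = gone (Gv v).
Proof.
move=> [w + <-]; elim: w => [_|[u g] w IH /= /andP[/asboolP uv /IH pw]] /=.
  exact: hom1 (@projM v).
by rewrite projM pw proj_iota_neq // gmul1.
Qed.

Lemma proj_finite x : exists s : seq {classic V},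
  forall v, vproj v x <> gone (Gv v) -> v \in s.
Proof.
have [w <-] := ev_onto x; exists (map (fun l => tag l : {classic V}) w) => v.
elim: w => [|[u g] w IH] /=; first by rewrite (hom1 (@projM v)).
rewrite (@in_cons {classic V}) projM; have [e|nuv] := pselect (u = v).
  by move=> _; apply/orP; left; apply/eqP.
by rewrite proj_iota_neq // gmul1 => /IH ->; rewrite orbT.
Qed.

(** * Geodesic words and word length *)

Definition geodesic w := forall w', ev w' = ev w -> size w <= size w'.

Lemma geodesic_exists x : exists w, geodesic w /\ ev w = x.
Proof.
have ex : exists n, `[< exists2 w, ev w = x & size w = n >].
  by have [w e] := ev_onto x; exists (size w); apply/asboolP; exists w.
have [n /asboolP[w e s] minn] := ex_minnP ex.
exists w; split=> // w' e'; rewrite s; apply: minn; apply/asboolP.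
by exists w' => //; rewrite e'.
Qed.

Definition geo x := sval (cid (geodesic_exists x)).
Definition glen x := size (geo x).

Lemma geoP x : geodesic (geo x). Proof. by rewrite /geo; case: cid => w []. Qed.

Lemma ev_geo x : ev (geo x) = x. Proof. by rewrite /geo; case: cid => w []. Qed.

Lemma glen_ev w : glen (ev w) <= size w.
Proof. by apply: geoP; rewrite ev_geo. Qed.

Lemma glen_geodesic w : geodesic w -> glen (ev w) = size w.
Proof.
by move=> gw; apply/eqP; rewrite eqn_leq glen_ev gw // ev_geo.
Qed.

Lemma glenM x y : glen (x ** y) <= glen x + glen y.
Proof.
by rewrite -{1}(ev_geo x) -{1}(ev_geo y) -ev_cat -size_cat; apply: glen_ev.
Qed.

Lemma glenV x : glen (ginv x) <= glen x.
Proof.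
suff H w : exists2 w', ev w' = ginv (ev w) & size w' = size w.
  have [w' e s] := H (geo x).
  by rewrite -{1}(ev_geo x) -e (leq_trans (glen_ev _)) // s.
elim: w => [|[v g] w [w' e s]] /=; first by exists [::]; rewrite ?ginv1.
exists (rcons w' (Tagged Gv (ginv g))); last by rewrite size_rcons s.
by rewrite -cats1 ev_cat e ev_cons (homV (@iotaM v)) gmulr1 ginvM.
Qed.

Lemma geodesic_infix w1 w2 w3 : geodesic (w1 ++ w2 ++ w3) -> geodesic w2.
Proof.
move=> gw w' e; have := gw (w1 ++ w' ++ w3).
by rewrite !ev_cat e !size_cat leq_add2l leq_add2r; apply.
Qed.

(** ** Normal forms at a vertex *)

Section Splitting.
Variable v : V.

Let C : P -> Prop := parabolic (fun u => adj u v).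
Let A : P -> Prop := parabolic (fun u => u <> v).

Lemma parabolic_link x : C x -> A x.
Proof.
move=> [w pw <-]; exists w => //; apply: (sub_all _ pw) => l /asboolP luv.
by apply/asboolP => e; apply: (graphV.2 v); rewrite -{1}e.
Qed.

Lemma link_comm x (g : Gv v) : C x -> x ** iota g = iota g ** x.
Proof.
move=> [w + <-]; elim: w => [|[u h] w IH] /=; first by rewrite !gsimp.
by move=> /andP[/asboolP uv /IH e]; rewrite -gmulA e !gmulA (iotaC uv).
Qed.

Lemma coset_eq x y : C (ginv x ** y) -> forall z, C (ginv x ** z) <-> C (ginv y ** z).
Proof.
move=> Cxy z; split=> Cz.
  by apply: parabolicMl Cxy _; rewrite !gsimp.
by have := parabolicM Cxy Cz; rewrite !gsimp.
Qed.

(** The set given to [xget] is the left coset [x C] and depends on that coset only, so all its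
    elements get one representative. Forcing 1 on [C] turns a comparison with 1 into a test for
    membership in [C]. *)
Definition coset_rep x : P :=
  if `[< C x >] then gone P else xget (gone P : {classic P}) [set t | C (ginv x ** t)].

Lemma coset_repP x : C (ginv (coset_rep x) ** x).
Proof.
rewrite /coset_rep; case: asboolP => [Cx|_]; first by rewrite ginv1 gmul1.
set t := xget _ _; have Ct : C (ginv x ** t).
  apply: (@xgetPex {classic P} (gone P) [set t | C (ginv x ** t)]); exists x.
  by rewrite /= gmulV; apply: parabolic1.
by have := parabolicV Ct; rewrite !gsimp.
Qed.

Lemma coset_rep_eq x y : C (ginv x ** y) -> coset_rep x = coset_rep y.
Proof.
move=> Cxy; rewrite /coset_rep; have e : C x = C y.
  by apply/propext; have := coset_eq Cxy (gone P); rewrite !gmulr1 => H; split;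
    move=> /parabolicV/H/parabolicV; rewrite ginvK.
have -> : [set t | C (ginv x ** t)] = [set t | C (ginv y ** t)].
  by apply/funext => z /=; apply/propext; apply: coset_eq.
by rewrite e.
Qed.

Lemma coset_rep1 x : coset_rep x = gone P <-> C x.
Proof.
split=> [e|Cx]; last by rewrite /coset_rep; case: asboolP.
by have := coset_repP x; rewrite e ginv1 gmul1.
Qed.

Lemma coset_rep_rep a x : coset_rep (a ** coset_rep x) = coset_rep (a ** x).
Proof. by apply: coset_rep_eq; rewrite !gsimp; apply: coset_repP. Qed.

Lemma coset_rep_id x : coset_rep (coset_rep x) = coset_rep x.
Proof. by have := coset_rep_rep (gone P) x; rewrite !gmul1. Qed.

(* A list [(t1, g1); ...; (tm, gm)] stands for the left coset
   [t1 g1 ... tm gm A] in the splitting of [P] as an amalgam of [A] and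
   [C * Gv v] over [C]: the [ti] are coset representatives modulo [C]. *)
Definition syll : Type := P * Gv v.

Fixpoint all_reduced (s : seq syll) : Prop :=
  if s is (t, g) :: s' then
    [/\ coset_rep t = t, g <> gone (Gv v), t <> gone P & all_reduced s']
  else True.

(** Only the first representative may be trivial: a later one would let the syllables on its two
    sides merge. *)
Definition reduced (s : seq syll) : Prop :=
  if s is (t, g) :: s' then
    [/\ coset_rep t = t, g <> gone (Gv v) & all_reduced s']
  else True.

Lemma all_reducedW s : all_reduced s -> reduced s.
Proof. by case: s => [|[t g] s] //= []. Qed.

(** In [a t = t' c], with [t'] a representative and [c] in [C], the remainder [c] commutes with the
    syllable [g] and is carried on to the next representative; the final coset of [A] absorbs the
    last remainder. *)
Fixpoint lact (a : P) (s : seq syll) : seq syll :=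
  if s is (t, g) :: s' then
    (coset_rep (a ** t), g) :: lact (ginv (coset_rep (a ** t)) ** (a ** t)) s'
  else [::].

Lemma size_lact a s : size (lact a s) = size s.
Proof. by elim: s a => [|[t g] s IH] a //=; rewrite IH. Qed.

Lemma lact1 s : reduced s -> lact (gone P) s = s.
Proof.
elim: s => [|[t g] s IH] //= [et _ /all_reducedW /IH es].
by rewrite !gmul1 et gmulV es.
Qed.

Lemma lactM a b s : lact a (lact b s) = lact (a ** b) s.
Proof.
elim: s a b => [|[t g] s IH] a b //=.
by rewrite coset_rep_rep -(gmulA a b) IH !gsimp.
Qed.

Lemma lact_all_reduced c s : C c -> all_reduced s -> all_reduced (lact c s).
Proof.
elim: s c => [|[t g] s IH] c Cc //= [et ng nt rs]; split=> //.
- exact: coset_rep_id.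
- move=> /coset_rep1 Cct; apply: nt; rewrite -et; apply/coset_rep1.
  exact: parabolicMl Cc Cct.
- by apply: IH rs; apply: coset_repP.
Qed.

Lemma lact_reduced a s : reduced s -> reduced (lact a s).
Proof.
case: s => [|[t g] s] //= [et ng rs]; split=> //; first exact: coset_rep_id.
by apply: lact_all_reduced rs; apply: coset_repP.
Qed.

(** [pop] and [push] identify reduced lists with pairs of an element of [Gv v] and a list whose
    representatives are all non-trivial; [vact] is translation of the first component. *)
Definition pop (s : seq syll) : Gv v * seq syll :=
  if s is (t, g) :: s' then
    if `[< t = gone P >] then (g, s') else (gone (Gv v), s)
  else (gone (Gv v), s).

Definition push (g : Gv v) (s : seq syll) : seq syll :=
  if `[< g = gone (Gv v) >] then s else (gone P, g) :: s.

Lemma pop_all_reduced s : reduced s -> all_reduced (pop s).2.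
Proof.
case: s => [|[t g] s] //= [et ng rs].
by case: asboolP => //= nt; split.
Qed.

Lemma pop_id s : all_reduced s -> pop s = (gone (Gv v), s).
Proof. by case: s => [|[t g] s] //= [_ _ nt _]; case: asboolP. Qed.

Lemma pushK g s : all_reduced s -> pop (push g s) = (g, s).
Proof.
move=> rs; rewrite /push; case: asboolP => [->|_]; first exact: pop_id.
by rewrite /=; case: asboolP.
Qed.

Lemma popK s : reduced s -> push (pop s).1 (pop s).2 = s.
Proof.
rewrite /push; case: s => [|[t g] s] /=; first by case: asboolP.
move=> [_ ng _]; have [->|nt] := pselect (t = gone P).
  by rewrite (asboolT (erefl (gone P))) /= (asboolF ng).
by rewrite (asboolF nt) /= asboolT.
Qed.

Lemma push_reduced g s : all_reduced s -> reduced (push g s).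
Proof.
rewrite /push; case: asboolP => [_|ng rs]; first exact: all_reducedW.
by split=> //; apply/coset_rep1; apply: parabolic1.
Qed.

Definition vact (g : Gv v) (s : seq syll) : seq syll :=
  push (g ** (pop s).1) (pop s).2.

Lemma size_vact g s : size (vact g s) <= (size s).+1.
Proof.
have le_push h s' : size (push h s') <= (size s').+1.
  by rewrite /push; case: asboolP.
apply: leq_trans (le_push _ _) _; rewrite ltnS.
by case: s => [|[t h] s] //=; case: asboolP.
Qed.

Lemma vact1 s : reduced s -> vact (gone (Gv v)) s = s.
Proof. by rewrite /vact gmul1; apply: popK. Qed.

Lemma vactM g h s : reduced s -> vact (g ** h) s = vact g (vact h s).
Proof.
move=> /pop_all_reduced rs.
by rewrite /vact pushK //= gmulA.
Qed.

Lemma vact_reduced g s : reduced s -> reduced (vact g s).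
Proof. by move=> /pop_all_reduced; apply: push_reduced. Qed.

Lemma lact_pop c s : C c -> reduced s ->
  pop (lact c s) = ((pop s).1, lact c (pop s).2).
Proof.
move=> Cc; case: s => [|[t g] s] //= [et _ _].
have [->|nt] := pselect (t = gone P).
  have -> : coset_rep (c ** gone P) = gone P by apply/coset_rep1; rewrite gmulr1.
  by rewrite (asboolT (erefl (gone P))) ginv1 gmul1 gmulr1.
rewrite (asboolF nt) asboolF //= => /coset_rep1 Cct; apply: nt.
by rewrite -et; apply/coset_rep1; apply: parabolicMl Cc Cct.
Qed.

Lemma lact_push c g s : C c -> lact c (push g s) = push g (lact c s).
Proof.
move=> Cc; rewrite /push; case: asboolP => // _ /=.
have -> : coset_rep (c ** gone P) = gone P by apply/coset_rep1; rewrite gmulr1.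
by rewrite ginv1 gmul1 gmulr1.
Qed.

Lemma lact_vact c g s : C c -> reduced s -> lact c (vact g s) = vact g (lact c s).
Proof. by move=> Cc rs; rewrite /vact lact_push // lact_pop. Qed.

Definition tree := {s | reduced s}.

Definition tlact (a : P) (s : tree) : tree :=
  exist reduced _ (lact_reduced a (svalP s)).

Definition tvact (g : Gv v) (s : tree) : tree :=
  exist reduced _ (vact_reduced g (svalP s)).

(** Van der Waerden's method: instead of multiplying normal forms, let [P] act on them. The
    relations that are not inherited from [P] are those between [v] and its link, and they hold by
    [lact_vact]. *)
Lemma tree_action_exists : exists F : P -> sym_group tree, [/\ is_hom F,
  forall (g : Gv v) s, sval (sfun (F (iota g)) s) = vact g (sval s) &
  forall u (g : Gv u) s, u <> v -> sval (sfun (F (iota g)) s) = lact (iota g) (sval s)].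
Proof.
have la1 s : tlact (gone P) s = s by apply: sig_eq; apply: lact1 (svalP s).
have laM a b s : tlact (a ** b) s = tlact a (tlact b s).
  by apply: sig_eq; rewrite /= lactM.
have va1 s : tvact (gone _) s = s by apply: sig_eq; apply: vact1 (svalP s).
have vaM a b s : tvact (a ** b) s = tvact a (tvact b s).
  by apply: sig_eq; apply: vactM (svalP s).
pose f u (g : Gv u) : sym_group tree :=
  if pselect (u = v) is left e then act_sym va1 vaM (ecast u (Gv u) e g)
  else act_sym la1 laM (iota g).
have [u g h||F [FM Fiota]] := @extend_hom _ f.
- rewrite /f; case: pselect => [e|_]; first by subst u; apply: act_sym_hom.
  by rewrite iotaM; apply: act_sym_hom.
- have comm u (uv : adj u v) (g : Gv u) (h : Gv v) :
      act_sym la1 laM (iota g) ** act_sym va1 vaM h =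
      act_sym va1 vaM h ** act_sym la1 laM (iota g).
    apply: symm_eq; apply/funext => s; apply: sig_eq => /=.
    by rewrite lact_vact //; [apply: parabolic_iota|apply: svalP].
  move=> u w uw g h; rewrite /f.
  case: pselect => [e|nu]; case: pselect => [e'|nw].
  + by case: (graphV.2 v); rewrite -{1}e -e'.
  + by subst u; rewrite comm //; apply: graphV.1.
  + by subst w; rewrite comm.
  + by rewrite -!act_sym_hom iotaC.
exists F; split=> // [g s|u g s nuv]; rewrite Fiota /f; case: pselect => // e.
by rewrite (Prop_irrelevance e erefl).
Qed.

Definition tree_action : P -> sym_group tree := sval (cid tree_action_exists).

Definition tact (x : P) (s : tree) : tree := sfun (tree_action x) s.

Lemma tact1 s : tact (gone P) s = s.
Proof. by rewrite /tact /tree_action; case: cid => F [FM _ _] /=; rewrite hom1. Qed.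

Lemma tactM x y s : tact (x ** y) s = tact x (tact y s).
Proof. by rewrite /tact /tree_action; case: cid => F [FM _ _] /=; rewrite FM. Qed.

Lemma tact_iota (g : Gv v) s : sval (tact (iota g) s) = vact g (sval s).
Proof. by rewrite /tact /tree_action; case: cid => F [/=]. Qed.

Lemma tact_iota_neq u (g : Gv u) s : u <> v ->
  sval (tact (iota g) s) = lact (iota g) (sval s).
Proof. by rewrite /tact /tree_action; case: cid => F [/= _ _]; apply. Qed.

Lemma tact_off a s : A a -> sval (tact a s) = lact a (sval s).
Proof.
move=> [w + <-]; elim: w => [_|[u g] w IH /= /andP[/asboolP uv /IH e]] /=.
  by rewrite tact1 lact1 //; apply: svalP.
by rewrite tactM tact_iota_neq // e lactM.
Qed.

(** * Syllable counts and geodesic words *)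

Definition vlen (x : P) : nat := size (sval (tact x (exist reduced [::] I))).

Definition isv (l : letter) : bool := `[< tag l = v >].

Lemma isvP (l : letter) : isv l -> exists g : Gv v, l = Tagged Gv g.
Proof. by case: l => u g /asboolP /= e; subst u; exists g. Qed.

Lemma vlen_le w : vlen (ev w) <= count isv w.
Proof.
rewrite /vlen; elim: w => [|[u g] w IH] /=; first by rewrite tact1.
rewrite tactM /isv /=; case: asboolP => [e|nuv].
  by subst u; rewrite tact_iota (leq_trans (size_vact _ _)).
by rewrite tact_iota_neq // size_lact.
Qed.

(* [nf m a b x]: [x] has a reduced expression [a g1 a1 ... gm b] with [m]
   syllables in [Gv v]. *)
Inductive nf : nat -> P -> P -> P -> Prop :=
| nf_syll a b (g : Gv v) : A a -> A b -> g <> gone (Gv v) ->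
    nf 1 a b (a ** iota g ** b)
| nf_mul m n a b c d x y : nf m a b x -> nf n c d y -> ~ C (b ** c) ->
    nf (m + n) a d (x ** y).

(** The hypothesis on [s] keeps [b] from merging with the first representative, so all [m] syllables
    are added to the list. Applied to the empty list, this shows that [m] and the coset [a C] depend
    on [x] only. *)
Lemma nf_tact m a b x : nf m a b x -> forall s : tree,
  (if sval s is (t, _) :: _ then ~ C (b ** t) else True) ->
  exists g s', sval (tact x s) = (coset_rep a, g) :: s' /\ (size s').+1 = m + size (sval s).
Proof.
elim=> {m a b x} [a b g Aa Ab ng|m n a b c d x y _ IHx _ IHy nC] s gs.
  exists g; rewrite -gmulA tactM tact_off // tactM tact_iota tact_off //.
  have -> : vact g (lact b (sval s)) = (gone P, g) :: lact b (sval s).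
    rewrite /vact; have -> : pop (lact b (sval s)) = (gone (Gv v), lact b (sval s)).
      case: s gs => -[|[t h] s] r //= nC.
      by case: asboolP => // /coset_rep1.
    by rewrite /push gmulr1; case: asboolP.
  rewrite /= gmulr1; eexists; split; first by [].
  by rewrite !size_lact.
have [g [s' [ey sy]]] := IHy _ gs.
have [|h [s'' [ex sx]]] := IHx (tact y s).
  rewrite ey => Cbc; apply: nC.
  by have := parabolicM Cbc (coset_repP c); rewrite !gsimp.
by exists h, s''; rewrite tactM; split=> //; rewrite sx ey /= sy addnA.
Qed.

Lemma nf_vlen m a b x : nf m a b x -> vlen x = m.
Proof.
move=> /nf_tact/(_ (exist reduced [::] I) I)[g [s' [+ e]]].
by rewrite /vlen => -> /=; rewrite e addn0.
Qed.

Lemma nf_first m n a b c d x : nf m a b x -> nf n c d x -> C a -> C c.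
Proof.
move=> /nf_tact/(_ (exist reduced [::] I) I)[g [s' [e _]]].
move=> /nf_tact/(_ (exist reduced [::] I) I)[h [s'' []]].
by rewrite e => -[ea _ _ _] /coset_rep1; rewrite ea coset_rep1.
Qed.

Lemma nf_gt0 m a b x : nf m a b x -> 0 < m.
Proof. by elim=> // {}m n ? ? ? ? ? ? _ m0 _ _ _; rewrite ltn_addr. Qed.

Lemma nf_inv m a b x : nf m a b x -> nf m (ginv b) (ginv a) (ginv x).
Proof.
elim=> {m a b x} [a b g Aa Ab ng|m n a b c d x y _ IHx _ IHy nC].
  rewrite !ginvM gmulA -(homV (@iotaM v)); apply: nf_syll; try exact: parabolicV.
  by move=> /ginv_eq1.
rewrite ginvM addnC; apply: nf_mul IHy IHx _ => /parabolicV.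
by rewrite !gsimp.
Qed.

Lemma nf_last m n a b c d x : nf m a b x -> nf n c d x -> C b -> C d.
Proof.
move=> /nf_inv nx /nf_inv ny /parabolicV Cb.
by have /parabolicV := nf_first nx ny Cb; rewrite ginvK.
Qed.

Lemma nf_mulr m a b x c : nf m a b x -> A c -> nf m a (b ** c) (x ** c).
Proof.
move=> nx Ac; elim: nx => {m a b x} [a b g Aa Ab ng|m n a b c' d x y nx _ ny IHy nC].
  by rewrite -gmulA; apply: nf_syll => //; apply: parabolicM.
by rewrite -gmulA; apply: nf_mul nx IHy nC.
Qed.

Lemma parabolic_off w : ~~ has isv w -> A (ev w).
Proof.
rewrite -all_predC => h; exists w => //.
by apply: (sub_all _ h) => l /=; rewrite /isv -asbool_neg.
Qed.

Lemma geodesic_syll (g : Gv v) w1 w2 :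
  geodesic (w1 ++ Tagged Gv g :: w2) -> g <> gone (Gv v).
Proof.
move=> gw e; have := gw (w1 ++ w2); rewrite !ev_cat ev_cons e (hom1 (@iotaM v)).
by rewrite gmul1 !size_cat /= addnS ltnn => /(_ erefl).
Qed.

(** If [w2] were in [C], then [h] could be moved across it and merged with [g], saving a letter. *)
Lemma geodesic_gap (g h : Gv v) w1 w2 w3 :
  geodesic (w1 ++ Tagged Gv g :: w2 ++ Tagged Gv h :: w3) -> ~ C (ev w2).
Proof.
move=> gw Cw; have := gw (w1 ++ Tagged Gv (g ** h) :: w2 ++ w3).
rewrite !(ev_cat, ev_cons) iotaM -!gmulA (gmulA _ (iota h) (ev w3)) (link_comm h Cw).
by rewrite !gmulA !size_cat /= !size_cat /= !addnS ltnn => /(_ erefl).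
Qed.

Lemma nf_geodesic w1 w2 w3 (g h : Gv v) :
  ~~ has isv w1 -> ~~ has isv w3 -> geodesic (w1 ++ Tagged Gv g :: w2 ++ Tagged Gv h :: w3) ->
  nf (count isv w2).+2 (ev w1) (ev w3) (ev (w1 ++ Tagged Gv g :: w2 ++ Tagged Gv h :: w3)).
Proof.
have [n] := ubnP (size w2); elim: n w1 w2 g => // n IH w1 w2 g le_n n1 n3 gw.
have A1 := parabolic_off n1.
have ng := geodesic_syll gw.
have n1g : nf 1 (ev w1) (gone P) (ev w1 ** iota g ** gone P).
  by apply: nf_syll => //; apply: parabolic1.
have [|nh2] := boolP (has isv w2).
  move=> /split_first[u1 [l [u2 [e /isvP[k el] nu1]]]]; subst l w2.
  have e : (u1 ++ Tagged Gv k :: u2) ++ Tagged Gv h :: w3 =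
     u1 ++ Tagged Gv k :: u2 ++ Tagged Gv h :: w3 by rewrite -catA.
  move: gw; rewrite e => gw.
  have ny := IH u1 u2 k _ nu1 n3 _.
  have -> : (count isv (u1 ++ Tagged Gv k :: u2)).+2 = 1 + (count isv u2).+2.
    move: nu1; rewrite has_count -leqNgt leqn0 => /eqP c1.
    by rewrite count_cat c1 /= /isv asboolT.
  rewrite ev_cat ev_cons gmulA -(gmulr1 (_ ** iota g)).
  apply: nf_mul n1g (ny _ _) _; last by rewrite gmul1; apply: geodesic_gap gw.
    by move: le_n; rewrite size_cat /= addnS => /ltnSE; apply: leq_trans; rewrite ltnS leq_addl.
  apply: (@geodesic_infix (w1 ++ [:: Tagged Gv g]) _ [::]).
  by rewrite cats0 -catA.
have -> : (count isv w2).+2 = 1 + 1.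
  by move: nh2; rewrite has_count -leqNgt leqn0 => /eqP ->.
have -> : ev (w1 ++ Tagged Gv g :: w2 ++ Tagged Gv h :: w3) =
    (ev w1 ** iota g ** gone P) ** (ev w2 ** iota h ** ev w3).
  by rewrite !(ev_cat, ev_cons) !gsimp.
apply: nf_mul n1g _ _; last by rewrite gmul1; apply: geodesic_gap gw.
apply: nf_syll; try exact: parabolic_off.
apply: (@geodesic_syll _ (w1 ++ Tagged Gv g :: w2) w3).
by rewrite -catA.
Qed.

Lemma nf_geo w : geodesic w -> has isv w -> exists w1 (g : Gv v) u u' (g' : Gv v) w2,
  [/\ w = w1 ++ Tagged Gv g :: u, w = u' ++ Tagged Gv g' :: w2,
      ~~ has isv w1, ~~ has isv w2 & nf (count isv w) (ev w1) (ev w2) (ev w)].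
Proof.
move=> gw /split_first[w1 [l [u [e /isvP[g el] n1]]]]; subst l.
have c1 : count isv w1 = 0.
  by apply/eqP; move: n1; rewrite has_count -leqNgt leqn0.
have [|nu] := boolP (has isv u); last first.
  exists w1, g, u, w1, g, u; split=> //.
  have -> : count isv w = 1 + 0.
    rewrite e count_cat c1 /= /isv asboolT //; congr (1 + _).
    by apply/eqP; move: nu; rewrite has_count -leqNgt leqn0.
  rewrite e ev_cat ev_cons gmulA; apply: nf_syll; try exact: parabolic_off.
  by apply: (@geodesic_syll g w1 u); rewrite -e.
move=> /split_last[w2 [l [w3 [eu /isvP[h el] n3]]]]; subst l u.
exists w1, g, (w2 ++ Tagged Gv h :: w3), (w1 ++ Tagged Gv g :: w2), h, w3.
split=> //; first by rewrite e -catA.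
have c3 : count isv w3 = 0.
  by apply/eqP; move: n3; rewrite has_count -leqNgt leqn0.
have -> : count isv w = (count isv w2).+2.
  by rewrite e count_cat /= count_cat /= c1 c3 /isv !asboolT //= !addn0 addn1.
by rewrite e; apply: nf_geodesic => //; rewrite -e.
Qed.

Lemma vlen_geo x : vlen x = count isv (geo x).
Proof.
have [|nh] := boolP (has isv (geo x)).
  move=> /(nf_geo (@geoP x))[? [? [? [? [? [? [_ _ _ _ /nf_vlen]]]]]]].
  by rewrite ev_geo.
have c0 : count isv (geo x) = 0.
  by apply/eqP; move: nh; rewrite has_count -leqNgt leqn0.
by have := vlen_le (geo x); rewrite c0 leqn0 ev_geo => /eqP.
Qed.

Lemma vlenM x y : vlen (x ** y) <= vlen x + vlen y.
Proof.
rewrite (vlen_geo x) (vlen_geo y) -count_cat -{1}(ev_geo x) -{1}(ev_geo y).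
by rewrite -ev_cat vlen_le.
Qed.

Lemma vlenX x k : vlen (gpow x k) <= k * vlen x.
Proof.
elim: k => [|k IH]; first by rewrite (vlen_le [::]).
by rewrite gpowS mulSn (leq_trans (vlenM _ _)) // leq_add2l.
Qed.

(** * Powers seen from one vertex: the dichotomy *)

Lemma nf_pow m a b x k : nf m a b x -> ~ C (b ** a) ->
  nf (k.+1 * m) a b (gpow x k.+1).
Proof.
move=> nx nC; elim: k => [|k IH]; first by rewrite mul1n /gpow /= gmulr1.
by rewrite gpowS mulSn; apply: nf_mul nx IH nC.
Qed.

(** The syllable count of the powers is unbounded and never below [m]. The ends stay outside [C] if
    those of [h] were, so that powers can be substituted into longer normal forms. *)
Definition hyperbolic m (a b h : P) := forall k, exists l b',
  [/\ m <= l, k < l, nf l a b' (gpow h k.+1) & C b' -> C b].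

(** The last clause says that [y] cannot be absorbed between [iota g] and its inverse: either it
    lies in [A] but not in [C], or it has its own syllables at [v] and both its ends are outside
    [C]. *)
Definition elliptic m (a b h : P) := exists (g : Gv v) y,
  [/\ h = (a ** iota g) ** y ** ginv (a ** iota g),
      [/\ A a, g <> gone (Gv v), C (b ** a) & glen y < glen h] &
      [/\ m = 2, A y & ~ C y] \/
      exists n a1 b1, [/\ m = n.+2, nf n a1 b1 y, ~ C a1 & ~ C b1]].

Lemma hyperbolic_conj n a b (g h : Gv v) y a1 b1 :
  A a -> g <> gone (Gv v) -> h <> gone (Gv v) -> h ** g <> gone (Gv v) ->
  C (b ** a) -> nf n a1 b1 y -> ~ C a1 -> ~ C b1 ->
  hyperbolic n.+2 a b (a ** iota g ** y ** iota h ** b).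
Proof.
move=> Aa ng nh nhg Cba ny nCa1 nCb1 k; set x := _ ** b.
(* As [b = c a^-1] and [c] commutes with [Gv v], the last syllable [h] of a factor of a power of [x]
   meets the first syllable [g] of the next one. They merge to [h g], which is non-trivial, so that
   [x ^ (j + 1) = a g z ^ j q] without further cancellation. *)
pose c := b ** a; have Ac : A c by apply: parabolic_link.
have A1 : A (gone P) by apply: parabolic1.
have AVa : A (ginv a) by apply: parabolicV.
have nb1c : ~ C (b1 ** c) by move=> /(parabolicMr Cba).
pose q := y ** (c ** iota h ** ginv a).
have nq : nf (n + 1) a1 (ginv a) q by apply: nf_mul ny (nf_syll Ac AVa nh) nb1c.
pose z := y ** (c ** iota (h ** g) ** gone P).
have nz : nf (n + 1) a1 (gone P) z by apply: nf_mul ny (nf_syll Ac A1 nhg) nb1c.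
have ex : x = a ** iota g ** q.
  have -> : x = a ** iota g ** y ** (iota h ** c) ** ginv a by rewrite /x /c !gsimp.
  by rewrite -(link_comm h Cba) /q !gsimp.
have ne j : nf (j.+1 * (n + 1)) a1 (ginv a) (gpow z j ** q).
  elim: j => [|j IH]; first by rewrite mul1n gmul1.
  by rewrite gpowS mulSn -gmulA; apply: nf_mul nz IH _; rewrite gmul1.
have eX j : gpow x j.+1 = a ** iota g ** gone P ** (gpow z j ** q).
  elim: j => [|j IH]; first by rewrite /gpow /= ex !gsimp.
  by rewrite gpowS IH ex gpowS {1}/q {2}/z iotaM !gsimp.
exists (1 + k.+1 * (n + 1)), (ginv a); split.
- by rewrite add1n ltnS addn1 leq_pmull.
- by rewrite add1n ltnS addn1 (leq_trans (leqnSn k)) // leq_pmulr.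
- by rewrite eX; apply: nf_mul (nf_syll Aa A1 ng) (ne k) _; rewrite gmul1.
- by move=> Ca; have := parabolicM Cba Ca; rewrite !gsimp.
Qed.

(** The trivial projection at [v] excludes a single syllable, and also two syllables [g], [h] with
    [h g <> 1]; what remains is decided by whether the two ends cancel cyclically. *)
Lemma hyperbolic_or_elliptic w : geodesic w -> has isv w ->
  vproj v (ev w) = gone (Gv v) -> exists m a b,
    nf m a b (ev w) /\ (hyperbolic m a b (ev w) \/ elliptic m a b (ev w)).
Proof.
move=> gw /split_first[w1 [l [u [e /isvP[g el] n1]]]]; subst l.
have ng : g <> gone (Gv v) by apply: (@geodesic_syll g w1 u); rewrite -e.
have A1 := parabolic_off n1.
have [|nu] := boolP (has isv u); last first.
  rewrite e ev_cat ev_cons !projM (proj_off A1) (proj_off (parabolic_off nu)).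
  by rewrite !gsimp proj_iota.
move=> /split_last[w2 [l [w3 [eu /isvP[h el] n3]]]] pr; subst l u.
have gw' := gw; rewrite e in gw'; have A3 := parabolic_off n3.
have nx := nf_geodesic n1 n3 gw'; rewrite -e in nx.
exists (count isv w2).+2, (ev w1), (ev w3); split=> //.
have [Cba|nCba] := pselect (C (ev w3 ** ev w1)); last first.
  left=> k; exists (k.+1 * (count isv w2).+2), (ev w3); split=> //.
  - exact: leq_pmull.
  - by rewrite leq_pmulr.
  - exact: nf_pow.
have nh : h <> gone (Gv v).
  by apply: (@geodesic_syll h (w1 ++ Tagged Gv g :: w2) w3); rewrite -catA.
have ex : ev w = ev w1 ** iota g ** ev w2 ** iota h ** ev w3.
  by rewrite e !(ev_cat, ev_cons) !gsimp.
have mid : has isv w2 -> exists a1 b1,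
    [/\ nf (count isv w2) a1 b1 (ev w2), ~ C a1 & ~ C b1].
  move=> hw2; have gw2 : geodesic w2.
    apply: (@geodesic_infix (w1 ++ [:: Tagged Gv g]) _ (Tagged Gv h :: w3)).
    by rewrite -catA.
  have [p1 [k [p2 [q1 [k' [q2 [e1 e2 _ _ n2]]]]]]] := nf_geo gw2 hw2.
  exists (ev p1), (ev q2); split=> //.
    by apply: (@geodesic_gap g k w1 p1 (p2 ++ Tagged Gv h :: w3)); move: gw'; rewrite e1 -catA.
  by apply: (@geodesic_gap k' h (w1 ++ Tagged Gv g :: q1) q2 w3); move: gw'; rewrite e2 -!catA.
have [nhg|nhg] := pselect (h ** g = gone (Gv v)); last first.
  left; rewrite ex; have [hw2|nw2] := boolP (has isv w2).
    have [a1 [b1 [n2 Ca1 Cb1]]] := mid hw2.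
    exact: hyperbolic_conj n2 _ _.
  case: nhg; move: pr; rewrite ex !projM !proj_iota (proj_off A1) (proj_off A3).
  rewrite (proj_off (parabolic_off nw2)) !gsimp => gh.
  by rewrite -[h ** g]gmul1 -{1}(gmulV g) -!gmulA (gmulA g h) gh gmul1 gmulV.
right; exists g, (ev w2 ** (ev w3 ** ev w1)); split.
- have eh : iota h = ginv (iota g).
    by apply: (@gmulrI _ (iota g)); rewrite gmulV -iotaM nhg (hom1 (@iotaM v)).
  rewrite ex; have -> : ev w3 = (ev w3 ** ev w1) ** ginv (ev w1) by rewrite !gsimp.
  move: (ev w3 ** ev w1) Cba => c Cc; rewrite -(gmulA _ (iota h)) (gmulA (iota h)).
  by rewrite -(link_comm h Cc) eh !gsimp.
- split=> //; rewrite glen_geodesic // e -!ev_cat (leq_ltn_trans (glen_ev _)) //.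
  by rewrite !size_cat /= !size_cat /=; lia.
have [hw2|nw2] := boolP (has isv w2).
  right; have [a1 [b1 [n2 Ca1 Cb1]]] := mid hw2.
  exists (count isv w2), a1, (b1 ** (ev w3 ** ev w1)); split=> //.
    by apply: nf_mulr n2 _; apply: parabolic_link.
  by move=> /(parabolicMr Cba).
left; split.
- by move: nw2; rewrite has_count -leqNgt leqn0 => /eqP ->.
- by apply: parabolicM (parabolic_off nw2) _; apply: parabolic_link.
- by move=> /(parabolicMr Cba); apply: geodesic_gap gw'.
Qed.

End Splitting.

(** * Powers of kernel elements *)

Definition in_kernel (x : P) := forall v, vproj v x = gone (Gv v).

Lemma kernel_conj p x : in_kernel (p ** x ** ginv p) -> in_kernel x.
Proof.
move=> kx v; have := kx v; rewrite !projM (homV (@projM v)) => e.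
apply: (@gmulI _ (vproj v p)); apply: (@gmulrI _ (ginv (vproj v p))).
by rewrite e !gsimp.
Qed.

(** Induction on the length. In the elliptic case the power of [h] is the same conjugate of the
    power of [y], and the conclusions on the ends keep that power from being absorbed by the
    conjugating syllables. *)
Lemma nf_kernel_pow h : in_kernel h -> forall v m a b, nf v m a b h ->
  forall k, exists l a' b', [/\ m <= l, nf v l a' b' (gpow h k.+1),
    parabolic (fun u => adj u v) a' -> parabolic (fun u => adj u v) a &
    parabolic (fun u => adj u v) b' -> parabolic (fun u => adj u v) b].
Proof.
have [n] := ubnP (glen h); elim: n h => // n IH h le_n kh v m a b nh k.
have hw : has (isv v) (geo h).
  by rewrite has_count -vlen_geo (nf_vlen nh); apply: nf_gt0 nh.
have := hyperbolic_or_elliptic (@geoP h) hw; rewrite ev_geo => /(_ (kh v)).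
move=> [m0 [a0 [b0 [nh0 cases]]]].
have em : m = m0 by rewrite -(nf_vlen nh) -(nf_vlen nh0).
subst m0; have Ca := nf_first nh0 nh; have Cb := nf_last nh0 nh.
case: cases => [/(_ k)[l [b' [le_l _ nl Cb']]]|].
  by exists l, a0, b'; split=> // /Cb'.
move=> [g [y [eh [Aa ng Cba lt_y] cases]]].
have ng' : ginv g <> gone (Gv v) by move=> /ginv_eq1.
have A1 : parabolic (fun u => u <> v) (gone P) by apply: parabolic1.
have AVa : parabolic (fun u => u <> v) (ginv a0) by apply: parabolicV.
have ky : in_kernel y by apply: (@kernel_conj (a0 ** iota g)); rewrite -eh.
have lt_yn : glen y < n by apply: leq_trans lt_y _.
have first_syll t : parabolic (fun u => u <> v) t ->
  nf v 1 a0 t (a0 ** iota g ** t) by move=> At; apply: nf_syll.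
have last_syll := nf_syll A1 AVa ng'.
have Cbb : parabolic (fun u => adj u v) (ginv a0) -> parabolic (fun u => adj u v) b.
  by move=> Ca0; apply: Cb; have := parabolicM Cba Ca0; rewrite !gsimp.
have ehk t : a0 ** iota g ** t ** ginv (a0 ** iota g) =
    a0 ** iota g ** t ** (gone P ** iota (ginv g) ** ginv a0).
  by rewrite (homV (@iotaM v)) !gsimp.
rewrite eh gpow_conj; case: cases => [[-> Ay nCy]|[n' [a1 [b1 [-> ny nCa1 nCb1]]]]].
  exists (1 + 1), a0, (ginv a0); split=> //.
  rewrite ehk; apply: nf_mul (first_syll _ _) last_syll _.
    exact: parabolicX.
  (* The power of [y] must not be in [C]. Some letter of [y] belongs to a vertex [u] outside the
     link of [v]; by induction at [u] the power still has a syllable at [u], whereas elements of [C]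
     have none. *)
  rewrite gmulr1 => -[w pw ew]; apply: nCy.
  rewrite -(ev_geo y); exists (geo y) => //; apply/negPn/negP; rewrite -has_predC.
  move=> /split_first[u1 [[u g'] [u2 [ey /asboolP nuv _]]]].
  have hu : has (isv u) (geo y) by rewrite ey has_cat /= /isv /= asboolT ?orbT.
  have [? [? [? [? [? [? [_ _ _ _ nu]]]]]]] := nf_geo (@geoP y) hu.
  rewrite ev_geo in nu.
  have [l [? [? [le_l nl _ _]]]] := IH y lt_yn ky u _ _ _ nu k.
  have := leq_trans (nf_gt0 nu) le_l; rewrite -(nf_vlen nl) -ew ltnNge.
  rewrite (leq_trans (vlen_le _ _)) // leqNgt -has_count -all_predC.
  apply: (sub_all _ pw) => l' /asboolP al /=; rewrite /isv -asbool_neg.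
  by apply/asboolP => el; apply: nuv; rewrite /= -el.
have [l [a' [b' [le_l nl Ca' Cb']]]] := IH y lt_yn ky v _ _ _ ny k.
exists (1 + l + 1), a0, (ginv a0); split=> //; first by rewrite addn1 add1n !ltnS.
rewrite ehk -(gmulr1 (a0 ** iota g)); apply: nf_mul _ last_syll _; last first.
  by rewrite gmulr1 => /Cb'.
by apply: nf_mul (first_syll _ A1) nl _; rewrite gmul1 => /Ca'.
Qed.

Lemma vlen_kernel_pow h k v : in_kernel h -> vlen v h <= vlen v (gpow h k.+1).
Proof.
move=> kh; have [|] := boolP (has (isv v) (geo h)); last first.
  by rewrite has_count -vlen_geo -leqNgt leqn0 => /eqP ->.
move=> /(nf_geo (@geoP h))[? [? [? [? [? [? [_ _ _ _ nh]]]]]]].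
rewrite ev_geo in nh; have [l [? [? [le_l nl _ _]]]] := nf_kernel_pow kh nh k.
by rewrite (nf_vlen nh) (nf_vlen nl).
Qed.

(** Where [h] is elliptic there may be no growth, so the vertex cannot be fixed in advance: in that
    case it is the one found for [y]. *)
Lemma vlen_kernel_growth h : in_kernel h -> h <> gone P ->
  exists v, forall k, k <= vlen v (gpow h k).
Proof.
have [n] := ubnP (glen h); elim: n h => // n IH h le_n kh nh.
have [v hv] : exists v, has (isv v) (geo h).
  case e: (geo h) => [|[v g] w]; first by case: nh; rewrite -(ev_geo h) e.
  by exists v; rewrite /= /isv asboolT.
have := hyperbolic_or_elliptic (@geoP h) hv; rewrite ev_geo => /(_ (kh v)).
move=> [m [a [b [_ [hyp|[g [y [eh [_ _ _ lt_y] _]]]]]]]].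
  exists v => -[//|k]; have [l [b' [_ lt_k nl _]]] := hyp k.
  by rewrite (nf_vlen nl).
move: (a ** iota g) eh => p eh.
have ky : in_kernel y by apply: (@kernel_conj p); rewrite -eh.
have [|u gy] := IH y (leq_trans lt_y le_n) ky.
  by move=> ey; apply: nh; rewrite eh ey !gsimp.
(* Conjugation changes the length by a bounded amount, which disappears on
   passing to high powers. *)
exists u => -[//|k]; rewrite leqNgt; apply/negP => /ltnSE lt_k.
(* With [c.+1] blocks, a deficit of one syllable per block exceeds the cost [c] of the
   conjugation. *)
pose c := vlen u (ginv p) + vlen u p.
have := gy (k.+1 * c.+1).
have -> : y = ginv p ** h ** ginv (ginv p) by rewrite eh !gsimp.
rewrite gpow_conj gpowM ginvK; set x := gpow (gpow h k.+1) c.+1.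
have le_x : vlen u x <= c.+1 * k.
  exact: leq_trans (vlenX u (gpow h k.+1) c.+1) (leq_mul (leqnn _) lt_k).
have le1 := vlenM u (ginv p ** x) p; have le2 := vlenM u (ginv p) x.
rewrite leqNgt => /negP; apply; rewrite mulSn addSn ltnS (leq_trans le1) //.
by rewrite (leq_trans (leq_add le2 (leqnn _))) // addnAC leq_add // mulnC.
Qed.

Lemma size_le_counts (w w' : seq letter) :
  (forall v, count (isv v) w <= count (isv v) w') -> size w <= size w'.
Proof.
move=> le_c; pose f (l : letter) : {classic V} := tag l.
rewrite -(size_map f w) -(size_map f w').
have /count_subseqP[s ss ps] : forall v, count_mem v (map f w) <= count_mem v (map f w').
  move=> v; rewrite !count_map; have := le_c v.
  congr (_ <= _); apply: eq_count => l /=; rewrite /isv; apply/asboolP/eqP => //.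
by rewrite (perm_size ps) size_subseq.
Qed.

(** The length is the sum of the syllable counts: the first bound compares them at all vertices, the
    second uses a single vertex where they grow. *)
Lemma glen_kernel_pow h k : in_kernel h -> h <> gone P ->
  (glen h <= glen (gpow h k.+1)) && (k < glen (gpow h k.+1)).
Proof.
move=> kh nh; apply/andP; split.
  by apply: size_le_counts => v; rewrite -!vlen_geo; apply: vlen_kernel_pow.
have [v gv] := vlen_kernel_growth kh nh.
by rewrite (leq_trans (gv k.+1)) // vlen_geo count_size.
Qed.

(** ** Dudley's argument *)

Section Dudley.
Variables (X : Type) (B : set (set X)) (phi : X -> P).

(** What the three classes have in common, with [B] a base of neighbourhoods of the unit. The
    neighbourhood may depend on the terms before [x n] and the exponent on those up to [x n]; [D]
    collects the elements to be shown absent near the unit. *)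
Definition solvable (G : group) (f : X -> G) :=
  forall (D : set X) (N : seq X -> set X) (k : seq X -> nat),
    (forall h, B (N h)) -> (forall U, B U -> exists2 x, U x & D x) ->
    exists x y : nat -> X, forall n,
      [/\ D (x n), N (mkseq x n) (x n), N (mkseq x n) (y n) &
          f (y n) = f (x n) ** gpow (f (y n.+1)) (k (mkseq x n.+1))].

Hypotheses (BI : forall U W, B U -> B W -> exists2 Z, B Z & Z `<=` U `&` W)
  (BT : exists U, B U) (solvable_phi : solvable phi).
Hypothesis phi_proj :
  forall v, exists2 U, B U & forall x, U x -> vproj v (phi x) = gone (Gv v).

Lemma kill_support (x : P) : exists2 U, B U & forall v, vproj v x <> gone (Gv v) ->
  forall z, U z -> vproj v (phi z) = gone (Gv v).
Proof.
have [s ps] := proj_finite x.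
suff [U BU Us] : exists2 U, B U & forall v, v \in s ->
    forall z, U z -> vproj v (phi z) = gone (Gv v).
  by exists U => // v /ps; apply: Us.
elim: s {ps} => [|u s [U BU Us]]; first by have [U BU] := BT; exists U.
have [W BW Wu] := phi_proj u; have [Z BZ ZUW] := BI BU BW.
exists Z => // v; rewrite in_cons => /orP[/eqP ->|vs] z /ZUW[Uz Wz].
  exact: Wu.
exact: Us.
Qed.

Lemma kill_supports (h : seq X) : exists2 U, B U & forall i, i < size h ->
  forall x0 v, vproj v (phi (nth x0 h i)) <> gone (Gv v) ->
  forall z, U z -> vproj v (phi z) = gone (Gv v).
Proof.
elim: h => [|x h [U BU Uh]]; first by have [U BU] := BT; exists U.
have [W BW Wx] := kill_support (phi x); have [Z BZ ZUW] := BI BU BW.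
exists Z => // -[_|i le_i] x0 v /= nv z /ZUW[Uz Wz]; first exact: Wx nv z Wz.
exact: Uh le_i x0 v nv z Uz.
Qed.

(* If every neighbourhood leaves the kernel of [P -> prod Gv], choosing terms
   with disjoint supports produces an element of infinite support. *)
Lemma near_in_kernel : exists2 U, B U & forall x, U x -> in_kernel (phi x).
Proof.
apply: contrapT => nU.
pose D : set X := [set x | exists v, vproj v (phi x) <> gone (Gv v)].
have meetD U : B U -> exists2 x, U x & D x.
  move=> BU; apply: contrapT => nx; apply: nU; exists U => // x Ux v.
  by apply: contrapT => nv; apply: nx; exists x => //; exists v.
have /choice[N NP] : forall h : seq X, exists U, B U /\ forall i, i < size h ->
    forall x0 v, vproj v (phi (nth x0 h i)) <> gone (Gv v) ->
    forall z, U z -> vproj v (phi z) = gone (Gv v).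
  by move=> h; have [U BU ?] := kill_supports h; exists U.
(* With all exponents 1, [y 0] plays the role of the infinite product of the [x n]. *)
have [//|x [y xy]] := @solvable_phi D N (fun=> 1) _ meetD; first by move=> h; case: (NP h).
have /choice[v vx] : forall n, exists v, vproj v (phi (x n)) <> gone (Gv v).
  by move=> n; case: (xy n).
have kill i n u z : i < n -> vproj u (phi (x i)) <> gone (Gv u) ->
    N (mkseq x n) z -> vproj u (phi z) = gone (Gv u).
  move=> lt_in nu Nz; have [_ /(_ i)] := NP (mkseq x n).
  by rewrite size_mkseq => /(_ lt_in (x 0) u); rewrite nth_mkseq //; apply.
(* Unfold [y i] down to [x n]. The factors before [x n] are trivial at [v n], since otherwise [x n]
   would have been chosen trivial there; [y n.+1] is trivial at [v n] because it lies in the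
   neighbourhood chosen after [x n]. *)
have vy n i : i <= n -> vproj (v n) (phi (y i)) <> gone (Gv (v n)).
  move=> le_in; rewrite -(subKn le_in); elim: (n - i) (leq_subr i n) => [_|d IH lt_dn].
    rewrite subn0; have [_ _ _ ->] := xy n; rewrite projM /gpow /= gmulr1.
    rewrite (kill n n.+1 (v n) (y n.+1)) ?gmulr1 //.
    by case: (xy n.+1).
  have [_ _ _ ->] := xy (n - d.+1); rewrite projM /gpow /= gmulr1 subnSK //.
  have -> : vproj (v n) (phi (x (n - d.+1))) = gone _.
    apply: contrapT => nx; apply: (vx n).
    by apply: (kill (n - d.+1) n _ _ _ nx); [lia | case: (xy n)].
  by rewrite gmul1; apply: IH; apply: ltnW.
have [s ps] := proj_finite (phi (y 0)).
have v_inj : injective (v : nat -> {classic V}).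
  move=> i j; wlog lt_ij : i j / i < j => [wlog_ij e|e].
    by case: (ltngtP i j) => // [/wlog_ij->//|/wlog_ij->].
  have [_ Nx _ _] := xy j; have := vx j.
  by have := kill i j (v i) (x j) lt_ij (vx i) Nx; rewrite e.
have := @uniq_leq_size {classic V} (map v (seq.iota 0 (size s).+1)) s.
rewrite size_map size_iota ltnn map_inj_uniq ?iota_uniq // => H.
suff : false by []. apply: H => // u /mapP[i _ ->]; apply: ps; exact: vy.
Qed.

(* Dudley's argument: in the equations [y n = x n * y n.+1 ^ k n], taking [k n]
   larger than the lengths of the [x i] seen so far bounds [n] by the length of
   [y 0] as long as [y n.+1] is non-trivial. *)
Lemma near_trivial : exists2 U, B U & forall x, U x -> phi x = gone P.
Proof.
have [U0 BU0 ker] := near_in_kernel.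
apply: contrapT => nU.
have meetD U : B U -> exists2 x, U x & phi x <> gone P.
  move=> BU; apply: contrapT => nx; apply: nU; exists U => // x Ux.
  by apply: contrapT => nv; apply: nx; exists x.
(* At stage [n] this is [n + 1] plus the lengths up to that of [x n]. The sum offsets the growth of
   the [y n] allowed by [le_y], and [n] eventually reaches the length of [y 0]. *)
pose k h := size h + \sum_(z <- h) glen (phi z).
have [x [y xy]] := @solvable_phi [set x | phi x <> gone P] (fun=> U0) k (fun=> BU0) meetD.
pose S n := \sum_(z <- mkseq x n) glen (phi z).
have SS n : S n.+1 = S n + glen (phi (x n)) by rewrite /S mkseqS big_rcons /= addnC.
have kS n : k (mkseq x n.+1) = (n + S n.+1).+1 by rewrite /k size_mkseq.
have le_pow n : glen (gpow (phi (y n.+1)) (k (mkseq x n.+1))) <=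
    glen (phi (x n)) + glen (phi (y n)).
  have [_ _ _ ->] := xy n.
  set p := gpow _ _; rewrite -{1}(gmulKl (phi (x n)) p).
  by rewrite (leq_trans (glenM _ _)) // leq_add2r glenV.
have ky n : in_kernel (phi (y n)) by apply: ker; case: (xy n).
have le_y n : glen (phi (y n)) <= glen (phi (y 0)) + S n.
  elim: n => [|n IH]; first exact: leq_addr.
  apply: (@leq_trans (glen (phi (x n)) + glen (phi (y n)))); last first.
    by rewrite SS addnA [X in _ <= X]addnC leq_add2l.
  have [->|ny] := pselect (phi (y n.+1) = gone P); first exact: leq_trans (glen_ev [::]) _.
  apply: leq_trans _ (le_pow n); rewrite kS.
  by have /andP[] := glen_kernel_pow (n + S n.+1) (ky n.+1) ny.
pose m := glen (phi (y 0)).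
have y1 n : m <= n -> phi (y n.+1) = gone P.
  move=> le_mn; apply: contrapT => ny.
  have /andP[_] := glen_kernel_pow (n + S n.+1) (ky n.+1) ny.
  by have := le_pow n; have := le_y n; move: le_mn; rewrite kS SS /m; lia.
(* Two consecutive trivial values of [phi \o y] force the term between them to be killed, against
   its choice. *)
have [nx _ _] := xy m.+1; rewrite (y1 m) // (y1 m.+1) // => e; apply: nx.
by rewrite e; elim: (k _) => [|j IH]; rewrite ?gmulr1 // gpowS gmul1.
Qed.

End Dudley.

End GraphProduct.

(** * Topological groups *)

(* Common to complete metric spaces ([F] the Frechet filter, [O m] the balls of
   radius [1 / (m + 1)]) and to locally compact ones ([F] a non-principal
   ultrafilter, [O m] compact neighbourhoods). *)
Definition nested_convergence (T : topologicalType) :=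
  exists F : set_system nat, [/\ ProperFilter F, \oo `<=` F &
    exists O : nat -> T -> set T, (forall m p, nbhs p (O m p)) /\
      forall (z : nat -> T) n,
        (forall m j, n <= m -> m <= j -> O m (z m) (z j)) ->
        exists l : T, z @ F --> l].

Section TopologicalGroups.
Variable T : topgroup.

Definition abstract_group : group :=
  Defs.Group (@tg_mulA T) (@tg_mul1 T) (@tg_mulV T).

Let TG := abstract_group.
Local Notation tone := (@tg_one T).

Lemma tmul_continuous (S : topologicalType) (f g : S -> tg_space T) :
  continuous f -> continuous g ->
  continuous (fun s => tg_mul (f s) (g s)).
Proof.
move=> fc gc s; apply: (@continuous_comp _ _ _ (fun s => (f s, g s))
  (fun p => tg_mul p.1 p.2)); last exact: tg_mul_cont.
by apply: cvg_pair; [apply: fc | apply: gc].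
Qed.

Definition root_map (x : TG) k (z : TG) : TG := x ** gpow z k.

Lemma root_map_continuous x k : continuous (root_map x k : tg_space T -> tg_space T).
Proof.
apply: tmul_continuous; first exact: cst_continuous.
elim: k => [|k IH]; first exact: cst_continuous.
by apply: tmul_continuous; [move=> z; apply: cvg_id | exact: IH].
Qed.

Lemma root_map1 x k : root_map x k (gone TG) = x.
Proof.
rewrite /root_map; elim: k => [|k IH]; first exact: gmulr1.
by rewrite gpowS gmul1.
Qed.

Variables (D : set TG) (N : seq TG -> set TG) (k : seq TG -> nat)
  (O : nat -> tg_space T -> set (tg_space T)).
Hypotheses (N1 : forall h, nbhs tone (N h)) (Oz : forall m p, nbhs p (O m p)).
Hypothesis meetD :
  forall U : set (tg_space T), nbhs tone U -> exists2 x, U x & D x.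

Definition choose_in (U : set TG) : TG :=
  xget (tone : {classic TG}) (U `&` D).

Lemma choose_inP U : nbhs tone U -> (U `&` D) (choose_in U).
Proof.
by move=> /meetD[x Ux Dx]; apply: (@xgetPex {classic TG} tone (U `&` D)); exists x.
Qed.

Definition control (fs : seq (TG -> TG)) m : set TG :=
  [set w | forall f, List.In f fs -> O m (f tone) (f w)].

Lemma control_nbhs fs m :
  (forall f, List.In f fs -> continuous (f : tg_space T -> tg_space T)) ->
  nbhs tone (control fs m).
Proof.
elim: fs => [|f fs IH] fc; first by apply: filterS filterT => w _ f [].
have nf : nbhs tone (f @^-1` O m (f tone)).
  by apply: fc (Oz m (f tone)); left.
have nfs := IH (fun g gi => fc g (or_intror gi)).
by apply: (filterS _ (filterI nf nfs)) => w [fw cw] g [<-|/cw].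
Qed.

(* The components are the terms [x 0, ..., x n.-1] chosen so far, the open
   neighbourhood of the unit where the next term is to be chosen, and the maps
   [F i \o ... \o F n.-1] for [F i := root_map (x i) (k [:: x 0; ...; x i])]
   and [i <= n]. *)
Record state := State {
  hist : seq TG; room : set TG; comps : seq (TG -> TG) }.

(** The preimage under [F] lets [nest] carry every later room into the earlier ones; [control]
    bounds how far the composed maps can move from their values at the unit. *)
Definition next (s : state) : state :=
  let x := choose_in (room s) in
  let h := rcons (hist s) x in
  let F := root_map x (k h) in
  let fs := id :: map (fun f => f \o F) (comps s) in
  State h (F @^-1` room s `&` (N h `&` control fs (size h))^°) fs.

Definition start : state :=
  State [::] (N [::] `&` control [:: id] 0)^° [:: id].

Definition run n : state := iter n next start.
Definition xs n : TG := choose_in (room (run n)).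
Definition Fs n : TG -> TG := root_map (xs n) (k (mkseq xs n.+1)).

Lemma hist_run n : hist (run n) = mkseq xs n.
Proof. by elim: n => // n IH; rewrite mkseqS -IH. Qed.

Lemma size_hist n : size (hist (run n)) = n.
Proof. by rewrite hist_run size_mkseq. Qed.

Lemma comps_continuous n f : List.In f (comps (run n)) ->
  continuous (f : tg_space T -> tg_space T).
Proof.
elim: n f => [|n IH] f /= [<-|]; try by move=> z; apply: cvg_id.
  by [].
move=> /List.in_map_iff[g [<- /IH gc]] z.
by apply: continuous_comp; [apply: root_map_continuous | apply: gc].
Qed.

Lemma room_run n : open (room (run n) : set (tg_space T)) /\ room (run n) tone.
Proof.
elim: n => [|n [oU U1]].
  split; first exact: open_interior.
  apply: filterI (N1 _) _; apply: control_nbhs => f /=.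
  by move=> [<-|[]] z; apply: cvg_id.
split.
  apply: openI; last exact: open_interior.
  by apply: open_comp oU => z _; apply: root_map_continuous.
split.
  rewrite /preimage /= root_map1.
  by have [] := choose_inP (open_nbhs_nbhs (conj oU U1)).
apply: filterI (N1 _) _; apply: control_nbhs => f fi.
exact: (@comps_continuous n.+1).
Qed.

Lemma xsP n : room (run n) (xs n) /\ D (xs n).
Proof. by have [] := choose_inP (open_nbhs_nbhs (room_run n)). Qed.

(** Its value at the unit is the truncation of [y n] after [d] terms. *)
Fixpoint nest d n : TG -> TG :=
  if d is d'.+1 then Fs n \o nest d' n.+1 else id.

Lemma nestD d e n w : nest (d + e) n w = nest d n (nest e (n + d) w).
Proof.
elim: d n => [|d IH] n; first by rewrite addn0.
by rewrite /= IH addSnnS.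
Qed.

Lemma nestSr d n : nest d.+1 n = nest d n \o Fs (n + d).
Proof.
elim: d n => [|d IH] n; first by rewrite addn0.
by rewrite [LHS]/= [nest d.+1 _ as X in _ \o X]IH addSnnS.
Qed.

Lemma Fs_next n : Fs n = root_map (xs n) (k (rcons (hist (run n)) (xs n))).
Proof. by rewrite /Fs hist_run mkseqS. Qed.

Lemma nest_comps d n : List.In (nest d n) (comps (run (n + d))).
Proof.
elim: d n => [|d IH] n; first by rewrite addn0; case: n => [|n]; left.
rewrite addnS; right; rewrite nestSr Fs_next.
by apply: (List.in_map (fun f => f \o _)); apply: IH.
Qed.

Lemma nest_room d n w : room (run (n + d)) w -> room (run n) (nest d n w).
Proof.
elim: d n => [|d IH] n; first by rewrite addn0.
by rewrite -addSnnS => /IH [+ _] /=; rewrite Fs_next.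
Qed.

Lemma room_control n w : room (run n) w ->
  N (mkseq xs n) w /\ control (comps (run n)) n w.
Proof.
rewrite -hist_run -{4}(size_hist n); case: n => [/interior_subset[] //|n].
by move=> [_ /interior_subset[]].
Qed.

Lemma nest_control m j n : n <= m -> m <= j ->
  O m (nest (m - n) n tone) (nest (j - n) n tone).
Proof.
move=> le_nm le_mj.
have -> : nest (j - n) n tone = nest (m - n) n (nest (j - m) m tone).
  by rewrite -{3}(subnKC le_nm) -nestD; congr (nest _ _ _); lia.
have [_] := room_run j; rewrite -{1}(subnKC le_mj) => /nest_room/room_control[_].
apply; have := nest_comps (m - n) n; by rewrite subnKC.
Qed.

Hypothesis T_hausdorff : hausdorff_space (tg_space T).
Variable F : set_system nat.
Hypotheses (F_proper : ProperFilter F) (F_oo : \oo `<=` F)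
  (O_conv : forall (z : nat -> tg_space T) n,
        (forall m j, n <= m -> m <= j -> O m (z m) (z j)) ->
        exists l : tg_space T, z @ F --> l)
  (N_closed : forall h, closed (N h : set (tg_space T))).

(** [y n] is the limit of its truncations. One filter [F] serves all [n], so the equations pass to
    the limit by continuity, and closedness keeps the limits in the prescribed neighbourhoods. *)
Lemma root_equations : exists x y : nat -> TG, forall n,
  [/\ D (x n), N (mkseq x n) (x n), N (mkseq x n) (y n) &
      y n = x n ** gpow (y n.+1) (k (mkseq x n.+1))].
Proof.
have /choice[y yP] : forall n, exists l : tg_space T,
    (fun j => nest (j - n) n tone) @ F --> l.
  by move=> n; apply: (O_conv (n := n)) => m j; apply: nest_control.
exists xs, y => n; split.
- by case: (xsP n).
- by have [/room_control[]] := xsP n.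
- apply: (closed_cvg (N (mkseq xs n)) _ _ (y n) (yP n)); first exact: N_closed.
  apply: F_oo; exists n => // j /= le_nj.
  have [_] := room_run j; rewrite -{1}(subnKC le_nj) => /nest_room.
  by move=> /room_control[].
- apply: (cvg_unique T_hausdorff (F := (fun j => nest (j - n) n tone) @ F)).
    exact: yP.
  have Fy : (Fs n \o (fun j => nest (j - n.+1) n.+1 tone)) @ F --> Fs n (y n.+1).
    by apply: cvg_comp (yP n.+1) _; apply: root_map_continuous.
  apply: cvg_trans Fy; apply: near_eq_cvg; apply: F_oo.
  by exists n.+1 => // j /= lt_nj; rewrite -[j - n]prednK ?subn_gt0 // -subnS.
Qed.

End TopologicalGroups.

Section Kernels.
Variables (T : topgroup) (G : group) (f : tg_space T -> G).
Hypothesis fM : is_thom f.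

Let fM' : is_hom (f : abstract_group T -> G). Proof. exact: fM. Qed.

Lemma translate_nbhs (U : set (tg_space T)) (x : tg_space T) :
  nbhs (@tg_one T) U -> nbhs x [set z | U (tg_mul (tg_inv x) z)].
Proof.
move=> U1; have c : continuous (fun z : tg_space T => tg_mul (tg_inv x) z).
  by apply: tmul_continuous; [apply: cst_continuous | move=> z; apply: cvg_id].
by apply: c; rewrite tg_mulV.
Qed.

(** Regularity of topological groups: if [W W'^-1] lies in [U] and [y] is adherent to the
    intersection of [W] and [W'], then [y W'] meets [W], so [y] lies in [W W'^-1]. *)
Lemma closed_nbhs (U : set (tg_space T)) : nbhs (@tg_one T) U ->
  exists W, [/\ nbhs (@tg_one T) W, closed W & W `<=` U].
Proof.
move=> U1; have c : continuous (fun p : tg_space T * tg_space T =>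
    tg_mul p.1 (tg_inv p.2)).
  apply: tmul_continuous; first by move=> p; apply: cvg_fst.
  by move=> p; apply: continuous_comp; [apply: cvg_snd | apply: tg_inv_cont].
have [|[W W'] /= [W1 W'1] WU] := c (@tg_one T, @tg_one T) U.
  have e : tg_mul (@tg_one T) (tg_inv (@tg_one T)) = @tg_one T.
    exact: (@gmulVr (abstract_group T)).
  by rewrite /= e.
exists (closure (W `&` W')); split.
- by apply: (filterS (@subset_closure _ _)); apply: filterI.
- exact: closed_closure.
move=> y cl; have [z [[Wz _] /= W'z]] := cl _ (translate_nbhs y W'1).
have e : tg_mul z (tg_inv (tg_mul (tg_inv y) z)) = y.
  have : (z : abstract_group T) ** ginv (ginv (y : abstract_group T) ** z) = y.
    by rewrite ginvM ginvK gmulA gmulVr gmul1.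
  by [].
by rewrite -e; apply: (WU (_, _)).
Qed.

Lemma near_kernel x z : f (tg_mul (tg_inv x) z) = gone G -> f z = f x.
Proof.
move=> e; have := gmulA (x : abstract_group T) (tg_inv x) z.
rewrite (gmulVr (x : abstract_group T)) gmul1 => <-.
by rewrite [LHS]fM' e gmulr1.
Qed.

Lemma kernel_open (U : set (tg_space T)) : nbhs (@tg_one T) U ->
  (forall x, U x -> f x = gone G) -> open [set x | f x = gone G].
Proof.
move=> U1 fU; rewrite openE => x /= fx.
apply: (filterS _ (translate_nbhs x U1)) => z /= /fU /near_kernel.
by rewrite fx.
Qed.

End Kernels.

Lemma metrizable_hausdorff (T : topologicalType) :
  completely_metrizable T -> hausdorff_space T.
Proof.
move=> [d [d0 [dxx [dC [dT [dopen _]]]]]].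
have oball (x : T) (e : R) : (0 < e)%R -> nbhs x [set y | d x y < e]%R.
  move=> e0; apply: open_nbhs_nbhs; split; last by rewrite /= (dxx x x).2.
  apply/dopen => y /= dxy; exists (e - d x y)%R => [|z /=]; first by rewrite subr_gt0.
  by have := dT x y z; lra.
move=> p q cl; apply/dxx/eqP; rewrite eq_le d0 andbT leNgt; apply/negP => pq0.
have h0 : (0 < d p q / 2)%R by lra.
have [z [/= pz qz]] := cl _ _ (oball p _ h0) (oball q _ h0).
by have := dT p z q; rewrite (dC z q); lra.
Qed.

Lemma metrizable_nested (T : topologicalType) :
  completely_metrizable T -> nested_convergence T.
Proof.
move=> [d [d0 [dxx [dC [dT [dopen dcomplete]]]]]].
exists \oo; split=> //; first exact: eventually_filter.
exists (fun m p => [set q | d p q < m.+1%:R^-1]%R); split=> [m p|z n zO].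
  have : (0 < m.+1%:R^-1 :> R)%R by rewrite invr_gt0 ltr0n.
  move: (_^-1)%R => r r0.
  apply: open_nbhs_nbhs; split; last by rewrite /= (dxx p p).2.
  apply/dopen => y /= dxy; exists (r - d p y)%R => [|z /=].
    by rewrite subr_gt0.
  by have := dT p y z; lra.
have [e e0|l zl] := dcomplete z; last first.
  exists l => U; rewrite nbhsE => -[W [oW Wl] WU].
  have [e e0 eW] := (dopen W).1 oW l Wl; have [m zm] := zl e e0.
  by exists m => // j /= mj; apply/WU/eW/zm.
have [m m_e] : exists m, (m.+1%:R^-1 < e / 2 :> R)%R.
  have h0 : (0 < e / 2)%R by lra.
  exists (Num.truncn (e / 2)^-1); rewrite invf_plt ?posrE ?ltr0n //.
  exact: truncnS_gt.
exists (maxn m n) => i j; rewrite !geq_max => /andP[mi ni] /andP[mj nj].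
have zm k : (maxn m n <= k)%N -> (d (z (maxn m n)) (z k) < e / 2)%R.
  move=> le_k; apply: le_lt_trans m_e; apply: le_trans (ltW (zO _ _ _ le_k)) _.
    exact: leq_maxr.
  by rewrite lef_pV2 ?posrE ?ltr0n // ler_nat ltnS leq_maxl.
have := zm i; have := zm j; have := dT (z i) (z (maxn m n)) (z j).
rewrite !geq_max mi ni mj nj (dC (z i) (z (maxn m n))) => h /(_ isT) hj /(_ isT) hi.
by lra.
Qed.

(** The condition at [m = n] keeps the sequence in a compact set, which yields a cluster point;
    along an ultrafilter this is a limit. *)
Lemma locally_compact_nested (T : topologicalType) :
  locally_compact [set: T] -> nested_convergence T.
Proof.
move=> lc; have [F [UF sF]] := @ultraFilterLemma nat \oo eventually_filter.
have /choice[K KP] : forall p : T, exists K, nbhs p K /\ compact K.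
  move=> p; have : compact_near (within [set: T] (nbhs p)) := lc p I.
  rewrite withinET.
  by move=> [U Up [cU _]]; exists U.
exists F; split; [exact: ultra_proper | by [] | exists (fun=> K)].
split=> [m p|z n zK]; first by case: (KP p).
have [|l [_ cl]] := (KP (z n)).2 (z @ F) _.
  by apply: sF; exists n => // j /= nj; apply: zK.
exists l => U Ul; have [//|FU] := in_ultra_setVsetC (z @^-1` U) UF.
by have [x []] := cl (~` U) U FU Ul.
Qed.

(** * The classes of cm-slender and lcH-slender groups *)

Section TopologicalSlender.
Variables (V : Type) (adj : V -> V -> Prop) (Gv : V -> group)
  (P : group) (iota : forall v, Gv v -> P).
Hypotheses (graphV : simple_graph adj) (prodP : is_graph_product adj iota).

Lemma hom_open_kernel (T : topgroup) (f : tg_space T -> P) :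
  hausdorff_space (tg_space T) -> nested_convergence (tg_space T) -> is_thom f ->
  (forall v, open [set x | vproj graphV prodP v (f x) = gone (Gv v)]) ->
  open [set x | f x = gone P].
Proof.
move=> hT [F [FF sF [Ob [Obp Obconv]]]] fM fopen.
suff [U U1 fU] : exists2 U, nbhs (@tg_one T) U & forall x, U x -> f x = gone P.
  exact: kernel_open U1 fU.
apply: (@near_trivial _ _ _ _ _ graphV prodP).
- by move=> U W U1 W1; exists (U `&` W) => //; apply: filterI.
- by exists setT; apply: filterT.
- move=> D N k N1 meetD.
  have /choice[N' N'P] h : exists W, [/\ nbhs (@tg_one T) W, closed W & W `<=` N h].
    exact: closed_nbhs.
  have [|||x [y xy]] := @root_equations T D N' k Ob _ Obp _ hT F FF sF Obconv _.
  + by move=> h; case: (N'P h).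
  + exact: meetD.
  + by move=> h; case: (N'P h).
  exists x, y => n; have [Dx Nx Ny e] := xy n.
  have fM' : is_hom (f : abstract_group T -> P) by [].
  have [_ _ subN] := N'P (mkseq x n); split; try exact: subN; first by [].
  by rewrite e [LHS]fM' (homX fM').
- move=> v; exists [set x | vproj graphV prodP v (f x) = gone (Gv v)] => //.
  apply: open_nbhs_nbhs; split=> //=.
  have fM' : is_hom (f : abstract_group T -> P) by [].
  by rewrite [f _](hom1 fM') (hom1 (@projM _ _ _ _ _ graphV prodP v)).
Qed.

Lemma cm_slender_graph_product : (forall v, cm_slender (Gv v)) -> cm_slender P.
Proof.
move=> sG T cm f fM; apply: hom_open_kernel => //.
- exact: metrizable_hausdorff.
- exact: metrizable_nested.
- by move=> v; apply: sG => // x y; rewrite fM; apply: projM.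
Qed.

Lemma lcH_slender_graph_product : (forall v, lcH_slender (Gv v)) -> lcH_slender P.
Proof.
move=> sG T lcH f fM; apply: hom_open_kernel => //; try by case: lcH.
- by case: lcH => _ /locally_compact_nested.
- by move=> v; apply: sG => // x y; rewrite fM; apply: projM.
Qed.

End TopologicalSlender.

(** * The Hawaiian earring *)

Local Open Scope ring_scope.

(* The library equips [R] with a topology and [R^o] with a normed structure;
   the following restate general facts for the former. *)
Section Continuity.
Variables (T : topologicalType) (t : T).
Implicit Types (f g : T -> R) (h : T -> R * R).

Lemma ctsD f g : {for t, continuous f} -> {for t, continuous g} ->
  {for t, continuous (fun s => f s + g s)}.
Proof. exact: (@continuousD R R^o T f g t). Qed.

Lemma ctsM f g : {for t, continuous f} -> {for t, continuous g} ->
  {for t, continuous (fun s => f s * g s)}.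
Proof. exact: (@continuousM R T f g t). Qed.

Lemma ctsV f : f t != 0 -> {for t, continuous f} ->
  {for t, continuous (fun s => (f s)^-1)}.
Proof. exact: (@continuousV R T f t). Qed.

Lemma cts_max f g : {for t, continuous f} -> {for t, continuous g} ->
  {for t, continuous (fun s => Num.max (f s) (g s))}.
Proof. exact: (@continuous_max R T f g t). Qed.

Lemma cts_min f g : {for t, continuous f} -> {for t, continuous g} ->
  {for t, continuous (fun s => Num.min (f s) (g s))}.
Proof. exact: (@continuous_min R T f g t). Qed.

Lemma cts_norm f : {for t, continuous f} -> {for t, continuous (fun s => `|f s|)}.
Proof. exact: (@cvg_norm R R^o T (nbhs t) _ f (f t)). Qed.

Lemma cts_add h h' : {for t, continuous h} -> {for t, continuous h'} ->
  {for t, continuous (fun s => h s + h' s)}.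
Proof. exact: (@continuousD R (R^o * R^o)%type T h h' t). Qed.

Lemma cts_dist h : {for t, continuous h} <->
  forall e : R, 0 < e -> \forall s \near t, `|h t - h s| < e.
Proof. exact: (@cvgrPdist_lt R (R^o * R^o)%type T (nbhs t) _ h (h t)). Qed.

Lemma cts_cst (S : topologicalType) (c : S) : {for t, continuous (fun=> c)}.
Proof. exact: cvg_cst. Qed.

Lemma cts_pair f g : {for t, continuous f} -> {for t, continuous g} ->
  {for t, continuous (fun s => (f s, g s))}.
Proof. exact: cvg_pair. Qed.

Lemma cts_fst h : {for t, continuous h} -> {for t, continuous (fun s => (h s).1)}.
Proof. by move=> hc; apply: (continuous_comp (f := h)) => //; apply: cvg_fst. Qed.

Lemma cts_snd h : {for t, continuous h} -> {for t, continuous (fun s => (h s).2)}.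
Proof. by move=> hc; apply: (continuous_comp (f := h)) => //; apply: cvg_snd. Qed.

End Continuity.

(** Loops are continuous on the unit interval only; composed with [clamp] they become continuous on
    the whole line. *)
Definition clamp (t : R) : R := Num.max 0 (Num.min 1 t).

Lemma clampE t : clamp t = if t <= 0 then 0 else if 1 <= t then 1 else t.
Proof.
rewrite /clamp; case: (leP 1 t) => t1.
  by rewrite max_r ?ler01 //; case: (leP t 0) => //; lra.
by case: (leP t 0).
Qed.

Lemma clamp_I01 t : I01 (clamp t).
Proof.
rewrite /I01 /= clampE; case: (leP t 0) => t0; first by rewrite lexx ler01.
by case: (leP 1 t) => t1; rewrite ?lexx ?ler01 // !ltW.
Qed.

Lemma clamp_le0 t : t <= 0 -> clamp t = 0.
Proof. by rewrite clampE => ->. Qed.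

Lemma clamp_ge1 t : 1 <= t -> clamp t = 1.
Proof. by move=> t1; rewrite clampE t1; case: (leP t 0) => //; lra. Qed.

Lemma clamp_id t : I01 t -> clamp t = t.
Proof.
rewrite /I01 /= clampE => /andP[t0 t1]; case: (leP t 0) => t0'; first lra.
by case: (leP 1 t) => t1' //; lra.
Qed.

Lemma I010 : I01 0. Proof. by rewrite /I01 /= lexx ler01. Qed.
Lemma I011 : I01 1. Proof. by rewrite /I01 /= lexx ler01. Qed.

Lemma clamp_continuous : continuous clamp.
Proof.
move=> t; apply: cts_max; first exact: cts_cst.
by apply: cts_min; [apply: cts_cst | apply: cvg_id].
Qed.

Lemma continuous_clamp (g : R -> R * R) :
  {within I01, continuous g} -> continuous (g \o clamp).
Proof.
move=> /subspace_continuousP gc t; apply: cvg_comp (gc _ (clamp_I01 t)).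
move=> W nW.
have := @clamp_continuous t [set s | I01 s -> W s] nW.
by apply: (@filterS _ (nbhs t)) => s /= /(_ (clamp_I01 s)).
Qed.

Lemma loop_intro (g h : R -> R * R) : continuous h ->
  (forall t, I01 t -> g t = h t) -> (forall t, I01 t -> earring (h t)) ->
  h 0 = base -> h 1 = base -> is_loop g.
Proof.
move=> hc gh hE h0 h1; split; last first.
  split; last by rewrite !gh //; [apply: I011 | apply: I010].
  by move=> t It; rewrite gh //; apply: hE.
apply: (@subspace_eq_continuous _ _ _ h); last exact: continuous_subspaceT.
by move=> t; rewrite inE => /gh /esym e; exact: e.
Qed.

Section Loops.
Variable g : R -> R * R.
Hypothesis gL : is_loop g.

Lemma loop_continuous : continuous (g \o clamp).
Proof. by case: gL => gc _; apply: continuous_clamp. Qed.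

Lemma loop_earring t : earring (g (clamp t)).
Proof. by case: gL => _ [gE _]; apply/gE/clamp_I01. Qed.

Lemma loop_le0 t : t <= 0 -> g (clamp t) = base.
Proof. by move=> /clamp_le0 ->; case: gL => _ [_ []]. Qed.

Lemma loop_ge1 t : 1 <= t -> g (clamp t) = base.
Proof. by move=> /clamp_ge1 ->; case: gL => _ [_ []]. Qed.

End Loops.

Lemma loop_eq g h : is_loop g -> (forall t, I01 t -> g t = h t) -> is_loop h.
Proof.
move=> gL gh; apply: (loop_intro (loop_continuous gL)) => [t It|t It||].
- by rewrite /= clamp_id // gh.
- exact: loop_earring.
- exact: loop_le0.
- exact: loop_ge1.
Qed.

Lemma homotopic_intro (g h : R -> R * R) (H : R * R -> R * R) :
  continuous H -> (forall p, earring (H p)) ->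
  (forall t, I01 t -> H (0, t) = g t /\ H (1, t) = h t) ->
  (forall s, H (s, 0) = base /\ H (s, 1) = base) -> loop_homotopic g h.
Proof.
move=> Hc HE Hgh Hb; exists H; split; first exact: continuous_subspaceT.
by split.
Qed.

(* As the base point is the origin, concatenation is a sum. *)
Lemma concat_sum g h t : is_loop g -> is_loop h -> I01 t ->
  loop_concat g h t = g (clamp (2 * t)) + h (clamp (2 * t - 1)).
Proof.
move=> gL hL /andP[t0 t1]; rewrite /loop_concat; case: leP => t2.
  rewrite (loop_le0 hL) ?subr_le0; last lra.
  by rewrite [base]/(0 : R * R) addr0 clamp_id // /I01 /=; lra.
rewrite (loop_ge1 gL); last lra.
by rewrite [base]/(0 : R * R) add0r clamp_id // /I01 /=; lra.
Qed.

Lemma affine_continuous (a b : R) : continuous (fun t : R => a * t + b).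
Proof.
move=> t; apply: ctsD; last exact: cts_cst.
by apply: ctsM; [apply: cts_cst | apply: cvg_id].
Qed.

Lemma concat_loop g h : is_loop g -> is_loop h -> is_loop (loop_concat g h).
Proof.
move=> gL hL.
pose G (t : R) := (g \o clamp) (2 * t + 0) + (h \o clamp) (2 * t + - 1).
have eG t : I01 t -> loop_concat g h t = G t.
  by move=> It; rewrite concat_sum // /G /= addr0.
apply: (loop_intro (h := G)) => // [t|t It||].
- apply: (@cts_add _ t (fun t => (g \o clamp) (2 * t + 0))
      (fun t => (h \o clamp) (2 * t + - 1))).
    apply: (@continuous_comp _ _ _ (fun t : R => 2 * t + 0) (g \o clamp)).
      exact: affine_continuous.
    exact: loop_continuous.
  apply: (@continuous_comp _ _ _ (fun t : R => 2 * t + - 1) (h \o clamp)).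
    exact: affine_continuous.
  exact: loop_continuous.
- rewrite -eG // /loop_concat; case: leP => t2; case: gL => _ [gE _]; case: hL => _ [hE _].
    by apply: gE; move: It; rewrite /I01 /=; lra.
  by apply: hE; move: It; rewrite /I01 /=; lra.
- by rewrite /G /= (loop_le0 gL) ?(loop_le0 hL) ?[base]/(0 : R * R) ?addr0 //; lra.
- by rewrite /G /= (loop_ge1 gL) ?(loop_ge1 hL) ?[base]/(0 : R * R) ?addr0 //; lra.
Qed.

Lemma circleE n p : circle n p <-> p.1 ^+ 2 + p.2 ^+ 2 = 2 * p.2 * n.+1%:R^-1.
Proof.
rewrite /circle /=; move: (n.+1%:R^-1) => r.
by split=> e; nra.
Qed.

Lemma circle_base n : circle n base.
Proof. by apply/circleE; rewrite /base /=; ring. Qed.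

Lemma circle_norm n p : circle n p -> `|p| <= 2 * n.+1%:R^-1.
Proof.
move=> /circleE; have : 0 < n.+1%:R^-1 :> R by rewrite invr_gt0 ltr0n.
move: (n.+1%:R^-1) => r r0; case: p => x y /= e.
have y0 : 0 <= y by rewrite leNgt; apply/negP => y0; nra.
have sx := sqr_ge0 x; have sy := sqr_ge0 (y - r).
have y2 : y <= 2 * r.
  rewrite leNgt; apply/negP => y2.
  by have : 0 < (y - 2 * r) * y by [apply: mulr_gt0; lra]; nra.
have x1 : x <= r.
  rewrite leNgt; apply/negP => x1.
  by have : 0 < (x - r) * (x + r) by [apply: mulr_gt0; lra]; nra.
have x2 : - r <= x.
  rewrite leNgt; apply/negP => x2.
  by have : 0 < (- r - x) * (r - x) by [apply: mulr_gt0; lra]; nra.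
by rewrite prod_normE /= ge_max !ler_norml; lra.
Qed.

Lemma circle_disjoint m n p : m <> n -> circle m p -> circle n p -> p = base.
Proof.
move=> mn /circleE em /circleE en; case: p em en => x y /= em en.
have y0 : y = 0.
  have : 2 * y * (m.+1%:R^-1 - n.+1%:R^-1) = 0 by rewrite mulrBr -em -en subrr.
  move=> /eqP; rewrite !mulf_eq0 subr_eq0 pnatr_eq0 /= => /orP[/eqP //|/eqP/invr_inj/eqP].
  by rewrite eqr_nat => /eqP[].
have x0 : x = 0 by apply/eqP; rewrite -sqrf_eq0; move: em; rewrite y0 expr0n addr0 mulr0 mul0r => ->.
by rewrite x0 y0.
Qed.

(** * Large circles ([head]) and small circles ([tail]) *)

Definition tail (N : nat) : set (R * R) := \bigcup_(n in [set n | (N <= n)%N]) circle n.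
Definition head (N : nat) : set (R * R) := \bigcup_(n in [set n | (n < N)%N]) circle n.

Lemma tail_base N : tail N base.
Proof. by exists N => //=; apply: circle_base. Qed.

Lemma tailW m n : (m <= n)%N -> tail n `<=` tail m.
Proof. by move=> mn p [i /= ni ip]; exists i => //=; apply: leq_trans mn ni. Qed.

Lemma tail_earring N : tail N `<=` earring.
Proof. by move=> p [i _ ip]; exists i. Qed.

Lemma head_or_tail N p : earring p -> head N p \/ tail N p.
Proof. by move=> [n _ np]; case: (ltnP n N) => nN; [left|right]; exists n. Qed.

Lemma head_tail N p : head N p -> tail N p -> p = base.
Proof.
move=> [m /= mN pm] [n /= Nn pn]; apply: (circle_disjoint _ pm pn) => e.
by rewrite e ltnNge Nn in mN.
Qed.

Lemma tail_norm N p : tail N p -> `|p| <= 2 * N.+1%:R^-1.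
Proof.
move=> [n /= Nn /circle_norm]; move/le_trans; apply.
by rewrite ler_pM2l // lef_pV2 ?posrE ?ltr0n // ler_nat.
Qed.

Lemma retr_head N p : head N p -> retr N p = p.
Proof. by move=> [n nN pn]; rewrite /retr asboolT //; exists n. Qed.

Lemma retr_tail N p : tail N p -> retr N p = base.
Proof.
move=> pT; rewrite /retr; case: asboolP => // -[n nN pn].
by apply: head_tail pT; exists n.
Qed.

Definition tail_loop N : set (R -> R * R) :=
  [set g | is_loop g /\ forall t, I01 t -> tail N (g t)].

Lemma tail_loopW m n : (m <= n)%N -> tail_loop n `<=` tail_loop m.
Proof. by move=> mn g [gL gT]; split=> // t /gT; apply: tailW. Qed.

Lemma const_loop N : tail_loop N (fun=> base).
Proof.
split; last by move=> t _; apply: tail_base.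
apply: (@loop_intro _ (fun=> base)) => // [t|t _]; first exact: cvg_cst.
exact: tail_earring (tail_base 0).
Qed.

Lemma concat_tail N g h : tail_loop N g -> tail_loop N h ->
  tail_loop N (loop_concat g h).
Proof.
move=> [gL gT] [hL hT]; split; first exact: concat_loop.
move=> t It; rewrite /loop_concat; case: leP => t2.
  by apply: gT; move: It; rewrite /I01 /=; lra.
by apply: hT; move: It; rewrite /I01 /=; lra.
Qed.

Definition loop_pow k g : R -> R * R := iter k (loop_concat g) (fun=> base).

Lemma loop_powS k g : loop_pow k.+1 g = loop_concat g (loop_pow k g).
Proof. by []. Qed.

Lemma pow_tail N g k : tail_loop N g -> tail_loop N (loop_pow k g).
Proof.
move=> gN; elim: k => [|k IH]; first exact: const_loop.
exact: concat_tail.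
Qed.

Lemma pow_loop g k : is_loop g -> is_loop (loop_pow k g).
Proof.
move=> gL; suff [] : tail_loop 0 (loop_pow k g) by [].
by apply: pow_tail; split=> // t /gL.2.1[n _ gn]; exists n.
Qed.

(** The time [u] does not depend on [g]: a power reads its argument at one time, so pointwise
    arguments pass through the exponents. *)
Lemma pow_pointwise k t : I01 t ->
  (forall g, loop_pow k g t = base) \/
  exists2 u, I01 u & forall g, loop_pow k g t = g u.
Proof.
elim: k t => [|k IH] t It; first by left.
case: (leP t 2^-1) => t2.
  right; exists (2 * t); first by move: It; rewrite /I01 /=; lra.
  by move=> g; rewrite loop_powS /loop_concat t2.
have [|H|[u Iu H]] := IH (2 * t - 1); first by move: It; rewrite /I01 /=; lra.
  by left=> g; rewrite loop_powS /loop_concat leNgt t2 H.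
by right; exists u => // g; rewrite loop_powS /loop_concat leNgt t2 H.
Qed.

(** * Infinite concatenations of loops *)

Section NestedConcatenation.
Variables (x : nat -> R -> R * R) (k : nat -> nat).
Hypothesis xT : forall n, tail_loop n (x n).

Fixpoint approx d n : R -> R * R :=
  if d is d'.+1 then loop_concat (x n) (loop_pow (k n) (approx d' n.+1))
  else fun=> base.

Lemma approx_tail d n j :
  (forall m, (n <= m)%N -> tail_loop j (x m)) -> tail_loop j (approx d n).
Proof.
elim: d n => [|d IH] n xj; first exact: const_loop.
apply: concat_tail; first exact: xj.
by apply/pow_tail/IH => m nm; apply/xj/ltnW.
Qed.

Lemma approx_loop d n : is_loop (approx d n).
Proof. by have [] := @approx_tail d n 0 (fun m _ => tail_loopW (leq0n m) (@xT m)). Qed.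

(* At a given time the approximations stay at the base point until they reach
   their final value. *)
Lemma approx_stable d e n t : I01 t -> approx d n t <> base ->
  approx (d + e) n t = approx d n t.
Proof.
elim: d n t => [//|d IH] n t It /=; rewrite /loop_concat; case: leP => // t2.
have It' : I01 (2 * t - 1) by move: It; rewrite /I01 /=; lra.
case: (pow_pointwise (k n) It') => [H|[u Iu H]]; rewrite !H //.
exact: IH.
Qed.

(** Where [d] stages have not left the base point, later ones only reach circles of index at least
    [n + d]. Together with [approx_stable] this makes the convergence uniform, hence the limit
    continuous. *)
Lemma approx_tail_base d e n t : I01 t -> approx d n t = base ->
  tail (n + d) (approx (d + e) n t).
Proof.
elim: d n t => [|d IH] n t It.
  rewrite addn0 add0n => _; have [_ H] := @approx_tail e n n
    (fun m nm => tail_loopW nm (@xT m)).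
  exact: H.
rewrite /= /loop_concat; case: leP => [_ ->|t2]; first exact: tail_base.
have It' : I01 (2 * t - 1) by move: It; rewrite /I01 /=; lra.
case: (pow_pointwise (k n) It') => [H|[u Iu H]]; rewrite !H => eb.
  exact: tail_base.
by rewrite addnS -addSn; apply: IH.
Qed.

Definition nested n t : R * R :=
  if pselect (exists d, approx d n t <> base) is left ex then
    approx (sval (cid ex)) n t
  else base.

Lemma nested_eventually n t : I01 t ->
  exists d, forall e, (d <= e)%N -> approx e n t = nested n t.
Proof.
move=> It; rewrite /nested; case: pselect => [ex|nex]; last first.
  by exists 0%N => e _; apply: contrapT => ne; apply: nex; exists e.
case: cid => d /= nd; exists d => e de.
by rewrite -(subnKC de); apply: approx_stable.
Qed.

Lemma nested_equation n t : I01 t ->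
  nested n t = loop_concat (x n) (loop_pow (k n) (nested n.+1)) t.
Proof.
move=> It; have [d dP] := nested_eventually n It.
rewrite /loop_concat; case: leP => t2.
  by rewrite -(dP d.+1) //= /loop_concat t2.
have It' : I01 (2 * t - 1) by move: It; rewrite /I01 /=; lra.
case: (pow_pointwise (k n) It') => [H|[u Iu H]]; rewrite H.
  by rewrite -(dP d.+1) //= /loop_concat leNgt t2 /= H.
have [d' d'P] := nested_eventually n.+1 Iu.
rewrite -(dP (maxn d d').+1); last by rewrite (leq_trans (leq_maxl d d')).
by rewrite /= /loop_concat leNgt t2 /= H d'P // leq_maxr.
Qed.

Lemma nested_tail n t j : I01 t -> (forall m, (n <= m)%N -> tail_loop j (x m)) ->
  tail j (nested n t).
Proof.
move=> It xj; have [d /(_ d (leqnn d)) <-] := nested_eventually n It.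
by have [_] := approx_tail d xj; apply.
Qed.

Lemma nested_approx d n t : I01 t ->
  `|nested n t - approx d n t| <= 2 * d.+1%:R^-1.
Proof.
move=> It; have [d' d'P] := nested_eventually n It.
have [e|ne] := pselect (approx d n t = base).
  rewrite e [base]/(0 : R * R) subr0 -(d'P (d + d')%N (leq_addl _ _)).
  apply: tail_norm; apply: tailW (approx_tail_base _ It e).
  exact: leq_addl.
rewrite -(d'P (d + d')%N (leq_addl _ _)) approx_stable // subrr normr0.
by rewrite mulr_ge0 // invr_ge0.
Qed.

Lemma nested_loop n : is_loop (nested n).
Proof.
have xn m : (n <= m)%N -> tail_loop 0 (x m) by move=> _; apply: tail_loopW (@xT m).
have end_base t : I01 t -> (forall d, approx d n t = base) -> nested n t = base.
  by move=> It ab; have [d /(_ d (leqnn d)) <-] := nested_eventually n It.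
apply: (@loop_intro _ (nested n \o clamp)) => [|t It|t It||].
- move=> t; apply/cts_dist => e e0.
  have [d de] : exists d : nat, d.+1%:R^-1 < e / 6.
    exists (Num.truncn (e / 6)^-1); rewrite invf_plt ?posrE ?ltr0n //; last by lra.
    exact: truncnS_gt.
  have e3 : 0 < e / 3 by lra.
  have /cts_dist/(_ _ e3) := loop_continuous (approx_loop d n) (x := t).
  apply: filterS => s /= lt_s.
  have le_t := nested_approx d n (clamp_I01 t).
  have le_s := nested_approx d n (clamp_I01 s).
  have := ler_distD (approx d n (clamp t)) (nested n (clamp t)) (nested n (clamp s)).
  have := ler_distD (approx d n (clamp s)) (approx d n (clamp t)) (nested n (clamp s)).
  rewrite (distrC (approx d n (clamp s)) (nested n (clamp s))).
  by move: le_t le_s de lt_s; move: (d.+1%:R^-1) => r; lra.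
- by rewrite /= clamp_id.
- rewrite /= clamp_id //; apply: (@tail_earring 0); exact: nested_tail.
- rewrite /= clamp_le0 //; apply: (end_base _ I010) => d.
  by case: (approx_loop d n) => _ [_ []].
- rewrite /= clamp_ge1 //; apply: (end_base _ I011) => d.
  by case: (approx_loop d n) => _ [_ []].
Qed.

End NestedConcatenation.

Section Homs.
Variables (G : group) (phi : (R -> R * R) -> G).
Hypothesis phiH : hawaii_hom phi.

Lemma phi_homotopic (g h : R -> R * R) (H : R * R -> R * R) :
  is_loop g -> is_loop h ->
  continuous H -> (forall p, earring (H p)) ->
  (forall t, I01 t -> H (0, t) = g t /\ H (1, t) = h t) ->
  (forall s, H (s, 0) = base /\ H (s, 1) = base) -> phi g = phi h.
Proof. by move=> gL hL Hc HE Hgh Hb; apply: phiH.1 => //; apply: homotopic_intro Hb. Qed.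

Lemma phi_eq g h : is_loop g -> (forall t, I01 t -> g t = h t) -> phi g = phi h.
Proof.
move=> gL gh.
apply: (@phi_homotopic _ _ (fun p => (g \o clamp) p.2)) => //.
- exact: loop_eq gh.
- move=> p; apply: (@continuous_comp _ _ _ snd (g \o clamp)).
    exact: cvg_snd.
  exact: loop_continuous.
- by move=> p; apply: loop_earring.
- by move=> t It /=; rewrite clamp_id // gh.
- by move=> s /=; rewrite (loop_le0 gL) // (loop_ge1 gL).
Qed.

Lemma phi_const : phi (fun=> base) = gone G.
Proof.
have [cL _] := const_loop 0.
apply: (@gmulI _ (phi (fun=> base))); rewrite gmulr1 -phiH.2 //.
apply/esym/phi_eq => // t _; by rewrite /loop_concat; case: leP.
Qed.

Lemma phi_pow g k : is_loop g -> phi (loop_pow k g) = gpow (phi g) k.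
Proof.
move=> gL; elim: k => [|k IH]; first exact: phi_const.
by rewrite gpowS -IH; apply: phiH.2 => //; apply: pow_loop.
Qed.

End Homs.

Lemma hawaii_solvable (G : group) (phi : (R -> R * R) -> G) : hawaii_hom phi ->
  solvable [set U | exists N, U = tail_loop N] phi.
Proof.
move=> phiH D U k BU meetD.
have /choice[NN NP] : forall h, exists N, U h = tail_loop N by exact: BU.
(* The maximum over all prefixes puts each term into every neighbourhood demanded so far, as [y n]
   contains all later terms; the prefix with [i = size h] also makes [x n] a loop in the circles
   from [n] on. *)
pose M h := \max_(i < (size h).+1) maxn (NN (take i h)) i.
have /choice[pick pickP] : forall h, exists g, tail_loop (M h) g /\ D g.
  by move=> h; have [|g] := meetD (tail_loop (M h)); [exists (M h) | exists g].
pose hist n := iter n (fun h => rcons h (pick h)) [::].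
pose x n := pick (hist n).
have hist_x n : hist n = mkseq x n by elim: n => // n IH; rewrite mkseqS -IH.
have xM n m : (n <= m)%N -> tail_loop (maxn (NN (mkseq x n)) n) (x m).
  move=> nm; have [+ _] := pickP (hist m); apply: tail_loopW.
  rewrite hist_x /M size_mkseq; have nm' : (n < m.+1)%N by [].
  apply: leq_trans (leq_bigmax (Ordinal nm')) => /=.
  by rewrite -map_take take_iota (minn_idPl nm).
have xT n : tail_loop n (x n).
  by apply: tail_loopW (xM n n (leqnn n)); apply: leq_maxr.
pose kk n := k (mkseq x n.+1).
exists x, (nested x kk) => n; split.
- by case: (pickP (hist n)).
- by rewrite NP; apply: tail_loopW (xM n n (leqnn n)); apply: leq_maxl.
- rewrite NP; split; first exact: nested_loop.
  move=> t It; apply: nested_tail => // m nm.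
  by apply: tail_loopW (xM n m nm); apply: leq_maxl.
- have yL m : is_loop (nested x kk m) by apply: nested_loop.
  rewrite (@phi_eq _ _ phiH _ (loop_concat (x n) (loop_pow (kk n) (nested x kk n.+1)))) //.
    rewrite phiH.2 ?(phi_pow phiH) //; first by case: (xT n).
    exact: pow_loop.
  by move=> t; apply: nested_equation.
Qed.

(** * Continuity of the retractions *)

Definition rho (p : R * R) : R := p.1 ^+ 2 + p.2 ^+ 2.

Lemma rho_ge0 p : 0 <= rho p.
Proof. by rewrite addr_ge0 ?sqr_ge0. Qed.

Lemma rho_gt0 p : p <> base -> 0 < rho p.
Proof.
move=> np; rewrite lt_neqAle rho_ge0 andbT eq_sym.
apply/eqP => /eqP; rewrite paddr_eq0 ?sqr_ge0 // !sqrf_eq0 => /andP[/eqP x0 /eqP y0].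
by apply: np; case: p x0 y0 => x y /= -> ->.
Qed.

Lemma rho_norm p q : rho p <= rho q -> `|p| <= 2 * `|q|.
Proof.
case: p q => [a b] [c d]; rewrite /rho !prod_normE /= => le_pq.
set M := Num.max `|c| `|d|; have M0 : 0 <= M by rewrite le_max normr_ge0.
have cM : `|c| <= M by rewrite le_max lexx.
have dM : `|d| <= M by rewrite le_max lexx orbT.
have c2 : c ^+ 2 <= M ^+ 2 by rewrite -real_normK ?num_real // ler_sqr ?nnegrE.
have d2 : d ^+ 2 <= M ^+ 2 by rewrite -real_normK ?num_real // ler_sqr ?nnegrE.
have sq z : z ^+ 2 <= a ^+ 2 + b ^+ 2 -> `|z| <= 2 * M.
  move=> le_z; rewrite -ler_sqr ?nnegrE ?mulr_ge0 // real_normK ?num_real //.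
  by have := sqr_ge0 M; lra.
rewrite ge_max !sq //; first by have := sqr_ge0 a; lra.
by have := sqr_ge0 b; lra.
Qed.

(** Negative inside and positive outside the circle of radius [1 / (N + 1/2)] tangent to those of
    the earring at the base point; it separates the circles of index below [N] from the others. *)
Definition sep N (p : R * R) : R := rho p - 4 * (N.*2.+1)%:R^-1 * p.2.

Lemma circle_snd n p : circle n p -> p.2 = n.+1%:R * rho p / 2.
Proof.
move=> /circleE e; have : n.+1%:R != 0 :> R by rewrite pnatr_eq0.
by rewrite /rho e; move: (n.+1%:R) => m m0; field.
Qed.

Lemma sep_circle N n p : circle n p ->
  sep N p = rho p * (N.*2.+1%:R - n.+1%:R *+ 2) / N.*2.+1%:R.
Proof.
move=> /circle_snd e; have : N.*2.+1%:R != 0 :> R by rewrite pnatr_eq0.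
rewrite /sep e mulr2n; move: (n.+1%:R) (N.*2.+1%:R) => m q q0; by field.
Qed.

Lemma sep_head N p : head N p -> p <> base -> 0 < sep N p.
Proof.
move=> [n /= nN pn] /rho_gt0 p0; rewrite (sep_circle _ pn) !mulr_gt0 ?invr_gt0 ?ltr0n //.
by rewrite subr_gt0 -mulrnA ltr_nat; lia.
Qed.

Lemma sep_tail N p : tail N p -> p <> base -> sep N p < 0.
Proof.
move=> [n /= nN pn] /rho_gt0 p0; rewrite (sep_circle _ pn).
rewrite pmulr_llt0 ?invr_gt0 ?ltr0n // pmulr_rlt0 //.
by rewrite subr_lt0 -mulrnA ltr_nat; lia.
Qed.

Lemma sep_gt0_head N p : earring p -> 0 < sep N p -> head N p.
Proof.
move=> pE s0; case: (head_or_tail N pE) => // pT.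
have [pb|np] := pselect (p = base); last by have := sep_tail pT np; lra.
by move: s0; rewrite pb /sep /rho /base /= expr0n addr0 mulr0 subr0 ltxx.
Qed.

Section ContinuousMaps.
Variable T : topologicalType.
Implicit Types f g : T -> R * R.

Lemma cts_dominated g f t : {for t, continuous g} -> g t = base ->
  (forall s, `|f s| <= 2 * `|g s|) -> {for t, continuous f}.
Proof.
move=> /cts_dist gc gt le_fg; apply/cts_dist => e e0.
have ft : f t = 0.
  by apply/eqP; rewrite -normr_le0 (le_trans (le_fg t)) // gt normr0 mulr0.
have e2 : 0 < e / 2 by lra.
apply: (@filterS _ (nbhs t) _ _ _ _ (gc _ e2)) => s.
by rewrite gt ft !sub0r !normrN; have := le_fg s; lra.
Qed.

Lemma cts_rho g t : {for t, continuous g} -> {for t, continuous (rho \o g)}.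
Proof.
move=> gc; apply: (@ctsD _ t (fun s => (g s).1 * (g s).1) (fun s => (g s).2 * (g s).2)).
  by apply: ctsM; apply: cts_fst.
by apply: ctsM; apply: cts_snd.
Qed.

Lemma cts_sep N g t : {for t, continuous g} -> {for t, continuous (sep N \o g)}.
Proof.
move=> gc; apply: (@ctsD _ t (rho \o g) (fun s => - (4 * (N.*2.+1)%:R^-1 * (g s).2))).
  exact: cts_rho.
have -> : (fun s => - (4 * (N.*2.+1)%:R^-1 * (g s).2)) =
    (fun s => - (4 * (N.*2.+1)%:R^-1) * (g s).2).
  by apply/funext => s; rewrite mulNr.
by apply: ctsM; [apply: cts_cst | apply: cts_snd].
Qed.

Lemma cts_near_gt0 (f : T -> R) t : {for t, continuous f} -> 0 < f t ->
  \forall s \near t, 0 < f s.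
Proof.
by move=> fc; apply: (@cvgr_gt R T (nbhs t) _ f (f t) fc).
Qed.

(** Where [g] is at the base point, the norm of [g] dominates; elsewhere the sign of [sep] is
    locally constant along [g]. *)
Lemma retr_continuous N g : continuous g -> (forall t, earring (g t)) ->
  continuous (retr N \o g).
Proof.
move=> gc gE t; have [gt|ngt] := pselect (g t = base).
  apply: (cts_dominated (gc t) gt) => s; rewrite /= /retr.
  by case: asboolP => _; rewrite ?[base]/(0 : R * R) ?normr0; have := normr_ge0 (g s); lra.
case: (head_or_tail N (gE t)) => [gH|gT].
  have near_head := cts_near_gt0 (@cts_sep N g t (gc t)) (sep_head gH ngt).
  apply: (@cvg_trans _ (g @ t)); last by rewrite /= (retr_head gH); apply: gc.
  apply: near_eq_cvg; apply: (filterS _ near_head) => s /= gs.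
  by rewrite retr_head //; apply: sep_gt0_head.
have near_tail : \forall s \near t, 0 < - sep N (g s).
  apply: cts_near_gt0; last by have := sep_tail gT ngt; lra.
  have -> : (fun s => - sep N (g s)) = (fun s => -1 * sep N (g s)).
    by apply/funext => s; rewrite mulN1r.
  apply: (@ctsM _ t (fun=> -1) (sep N \o g)); first exact: cts_cst.
  exact: (@cts_sep N g t (gc t)).
apply: (@cvg_trans _ ((fun=> base) @ t)).
  apply: near_eq_cvg; apply: (filterS _ near_tail) => s /= gs.
  case: (head_or_tail N (gE s)) => [sH|sT]; last by rewrite retr_tail.
  have [->|ns] := pselect (g s = base); first by rewrite retr_tail //; apply: tail_base.
  by exfalso; have := sep_head sH ns; lra.
by rewrite /= (retr_tail gT); apply: cvg_cst.
Qed.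

End ContinuousMaps.

(* Inversion in the unit circle maps the circles of the earring to parallel
   lines, the base point being at infinity.  [contract s] is conjugate under it
   to [(u, h) |-> (u / max (0, 1 - s |u|), h)]: it pushes a neighbourhood of the
   base point, namely [s |u| >= 1], to the base point. *)
Definition damp (s : R) (p : R * R) : R := Num.max 0 (1 - s * `|p.1| / rho p).
Definition cden s p : R := p.1 ^+ 2 + p.2 ^+ 2 * damp s p ^+ 2.
Definition contract (s : R) (p : R * R) : R * R :=
  (p.1 * damp s p * rho p / cden s p, p.2 * damp s p ^+ 2 * rho p / cden s p).

Lemma contract_base s : contract s base = base.
Proof. by rewrite /contract /base /= !mul0r. Qed.

Lemma cden_gt0 s p : p <> base -> 0 < cden s p.
Proof.
move=> np; have [x0|nx] := eqVneq p.1 0.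
  rewrite /cden /damp x0 normr0 mulr0 mul0r subr0 max_r ?ler01 // expr1n mulr1.
  by have := rho_gt0 np; rewrite /rho x0.
apply: ltr_pwDl; first by rewrite exprn_even_gt0.
by rewrite mulr_ge0 ?sqr_ge0.
Qed.

Lemma rho_contract s p : p <> base ->
  rho (contract s p) = (damp s p * rho p) ^+ 2 / cden s p.
Proof.
move=> np; have e := mulVf (lt0r_neq0 (cden_gt0 s np)).
rewrite -[RHS]mulr1 -e [LHS]/rho /contract /=.
by move: (_^-1) => i; rewrite /cden; move: (damp s p) (rho p) => m r; ring.
Qed.

(** On circle [n] the height [p.2 / rho p] of the inverted point is the constant [(n + 1) / 2], and
    a horizontal motion leaves it unchanged. *)
Lemma contract_circle n s p : circle n p -> circle n (contract s p).
Proof.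
have [->|np] := pselect (p = base); first by rewrite contract_base.
move=> /circleE e; apply/circleE; rewrite -[LHS]/(rho _) rho_contract //.
rewrite /contract /=; have -> : rho p = 2 * p.2 * n.+1%:R^-1 by [].
by ring.
Qed.

Lemma contract_earring s p : earring p -> earring (contract s p).
Proof. by move=> [n _ pn]; exists n => //; apply: contract_circle. Qed.

Lemma damp_ge0 s p : 0 <= damp s p. Proof. by rewrite le_max lexx. Qed.

Lemma damp_le1 s p : 0 <= s -> damp s p <= 1.
Proof.
move=> s0; rewrite ge_max ler01 gerBl divr_ge0 ?rho_ge0 //.
by rewrite mulr_ge0.
Qed.

Lemma contract_norm s p : 0 <= s -> `|contract s p| <= 2 * `|p|.
Proof.
move=> s0; have [->|np] := pselect (p = base).
  by rewrite contract_base; have := normr_ge0 base; lra.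
apply: rho_norm; rewrite rho_contract // ler_pdivrMr ?cden_gt0 //.
rewrite exprMn expr2 mulrA [leRHS]mulrC ler_wpM2r ?rho_ge0 //.
rewrite /cden /rho; have := damp_ge0 s p; have := damp_le1 p s0.
move: (damp s p) => m m1 m0; have m2 : m * m <= 1 by nra.
by have := sqr_ge0 p.1; nra.
Qed.

Lemma contract0 p : contract 0 p = p.
Proof.
have [->|np] := pselect (p = base); first exact: contract_base.
have r0 := lt0r_neq0 (rho_gt0 np).
have m1 : damp 0 p = 1 by rewrite /damp !mul0r subr0 max_r.
have d1 : cden 0 p = rho p by rewrite /cden m1 expr1n mulr1.
by rewrite /contract d1 m1 expr1n !mulr1 !mulfK //; case: p {np r0 m1 d1}.
Qed.

Lemma contract_continuous (T : topologicalType) (s : T -> R) (g : T -> R * R) :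
  continuous s -> continuous g -> (forall t, 0 <= s t) ->
  continuous (fun t => contract (s t) (g t)).
Proof.
move=> sc gc s0 t; have [gt|ngt] := pselect (g t = base).
  by apply: (cts_dominated (gc t) gt) => u; apply: contract_norm.
have xc : {for t, continuous (fun u => (g u).1)} := cts_fst (gc t).
have yc : {for t, continuous (fun u => (g u).2)} := cts_snd (gc t).
have rc : {for t, continuous (fun u => rho (g u))} := cts_rho (gc t).
have mc : {for t, continuous (fun u => damp (s u) (g u))}.
  apply: cts_max; first exact: cts_cst.
  apply: ctsD; first exact: cts_cst.
  have -> : (fun u => - (s u * `|(g u).1| / rho (g u))) =
      (fun u => -1 * (s u * `|(g u).1| / rho (g u))).
    by apply/funext => u; rewrite mulN1r.
  apply: ctsM; first exact: cts_cst.
  apply: ctsM; first by apply: ctsM; [apply: sc | apply: cts_norm].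
  by apply: ctsV => //; apply/lt0r_neq0/rho_gt0.
have dc : {for t, continuous (fun u => (cden (s u) (g u))^-1)}.
  apply: ctsV; first exact/lt0r_neq0/cden_gt0.
  apply: (@ctsD _ t (fun u => (g u).1 * (g u).1) (fun u => (g u).2 * (g u).2 *
    (damp (s u) (g u) * damp (s u) (g u)))); first exact: ctsM.
  by apply: ctsM; apply: ctsM.
apply: (@cts_pair _ t
  (fun u => (g u).1 * damp (s u) (g u) * rho (g u) / cden (s u) (g u))
  (fun u => (g u).2 * (damp (s u) (g u) * damp (s u) (g u)) * rho (g u) /
            cden (s u) (g u))); by do ![apply: ctsM => //].
Qed.

(** If a point [(x, y)] of circle [n < N] is not flattened by [contract 1], then [|x| < rho] and
    [|y| <= N rho], so [rho >= 1 / (1 + N ^ 2)]; the factor [2 N + 1 - 2 (n + 1)] in [sep_circle] is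
    at least 1. *)
Definition gap N : R := (N.*2.+1%:R * (1 + N%:R ^+ 2))^-1.

Lemma gap_gt0 N : 0 < gap N.
Proof. by rewrite invr_gt0 mulr_gt0 ?ltr0n // ltr_pwDl ?sqr_ge0. Qed.

Lemma contract1_far N n p : circle n p -> (n < N)%N -> contract 1 p <> base ->
  gap N <= sep N p.
Proof.
move=> pn nN ncp.
have np : p <> base by move=> pb; apply: ncp; rewrite pb contract_base.
have r0 := rho_gt0 np.
have xr : `|p.1| < rho p.
  rewrite ltNge; apply/negP => le_r; apply: ncp.
  have m0 : damp 1 p = 0.
    by rewrite /damp mul1r max_l // subr_le0 ler_pdivlMr // mul1r.
  by rewrite /contract m0 expr0n !mulr0 !mul0r.
rewrite (sep_circle _ pn) /gap invfM mulrC ler_pM2r ?invr_gt0 ?ltr0n //.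
have yr := circle_snd pn.
have nN' : n.+1%:R <= N%:R :> R by rewrite ler_nat.
have n0 : 0 < n.+1%:R :> R by rewrite ltr0n.
have le1 : 1 <= rho p * (1 + N%:R ^+ 2).
  have x2 : p.1 ^+ 2 <= rho p ^+ 2.
    by rewrite -real_normK ?num_real // ler_sqr ?nnegrE // ltW.
  have y2 : p.2 ^+ 2 <= rho p ^+ 2 * N%:R ^+ 2.
    rewrite yr !exprMn [leRHS]mulrC mulrAC ler_wpM2r ?sqr_ge0 //.
    have : n.+1%:R ^+ 2 <= N%:R ^+ 2 :> R by rewrite ler_sqr ?nnegrE // ltW // (lt_le_trans n0).
    have := sqr_ge0 (n.+1%:R : R); rewrite exprVn; lra.
  have : rho p <= rho p * (rho p * (1 + N%:R ^+ 2)).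
    rewrite {1}/rho mulrA -expr2 mulrDr mulr1; exact: lerD.
  by rewrite -{1}[rho p]mulr1 ler_pM2l.
have le2 : 1 <= N.*2.+1%:R - n.+1%:R *+ 2 :> R.
  by rewrite lerBrDr -mulrnA nat1r ler_nat; lia.
rewrite -[leLHS]mul1r ler_pdivrMr; last by rewrite ltr_pwDl ?sqr_ge0.
rewrite (le_trans le1) // mulrAC ler_peMr //.
by rewrite mulr_ge0 ?rho_ge0 // addr_ge0 ?sqr_ge0.
Qed.

Lemma uniformly_continuous_I01 (w : R -> R) (e : R) : continuous w -> 0 < e ->
  exists2 M : nat, (0 < M)%N &
    forall t u, I01 t -> I01 u -> `|t - u| <= M%:R^-1 -> `|w t - w u| < e.
Proof.
move=> wc e0; have e0' : Rdefinitions.Rlt 0 e by apply/RltP.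
have [|[d /= d0] unif] := Rtopology.Heine w _ (Rtopology.compact_P3 0 1) _
  (RIneq.mkposreal e e0').
  by move=> t _; apply/continuity_pt_cvg; apply: wc.
have d0' : 0 < d by apply/RltP.
exists (Num.truncn d^-1).+1 => // t u /andP[t0 t1] /andP[u0 u1] tu.
apply/RltP; rewrite -RabsE; apply: unif; try by split; apply/RleP.
apply/RltP; rewrite RabsE; apply: le_lt_trans tu _.
by rewrite invf_plt ?posrE ?ltr0n //; apply: truncnS_gt.
Qed.

(** * Cutting a loop into pieces *)

Definition piece (g : R -> R * R) (a b t : R) : R * R := g (clamp (a + (b - a) * t)).

Lemma piece_loop g a b : is_loop g -> g (clamp a) = base -> g (clamp b) = base ->
  is_loop (piece g a b).
Proof.
move=> gL ga gb; apply: (@loop_intro _ (piece g a b)) => // [t|t _||].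
- have -> : piece g a b = (g \o clamp) \o (fun t => (b - a) * t + a).
    by apply/funext => u; rewrite /piece /= addrC.
  apply: (@continuous_comp _ _ _ (fun t : R => (b - a) * t + a) (g \o clamp)).
    exact: affine_continuous.
  exact: (loop_continuous gL).
- exact: loop_earring.
- by rewrite /piece mulr0 addr0.
- by rewrite /piece mulr1 addrC subrK.
Qed.

Lemma retr_earring N p : earring p -> earring (retr N p).
Proof.
rewrite /retr; case: asboolP => // _ _; exact: tail_earring (tail_base 0).
Qed.

Lemma retr_base N : retr N base = base.
Proof. exact: retr_tail (tail_base N). Qed.

Lemma retr_loop N g : is_loop g -> is_loop (retr N \o g).
Proof.
move=> gL; have gE := loop_earring gL.
apply: (@loop_intro _ (retr N \o (g \o clamp))) => [|t It|t It||].
- exact: retr_continuous (loop_continuous gL) gE.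
- by rewrite /= clamp_id.
- by apply: retr_earring; apply: gE.
- by rewrite /= (loop_le0 gL) // retr_base.
- by rewrite /= (loop_ge1 gL) // retr_base.
Qed.

Section Decomposition.
Variables (G : group) (phi : (R -> R * R) -> G).
Hypothesis phiH : hawaii_hom phi.

(** Both sides run [g] along paths in the line from [a] to [c]; the straight-line homotopy of these
    paths is composed with [g]. *)
Lemma phi_piece g a b c : is_loop g ->
  g (clamp a) = base -> g (clamp b) = base -> g (clamp c) = base ->
  phi (piece g a c) = phi (piece g a b) ** phi (piece g b c).
Proof.
move=> gL ga gb gc; rewrite -phiH.2; try exact: piece_loop.
(* One formula for both halves of the concatenation: each [clamp] is constant while the other one
   moves. *)
pose theta t := a + (b - a) * clamp (2 * t + 0) + (c - b) * clamp (2 * t + - 1).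
have thetac (S : topologicalType) (f : S -> R) :
    continuous f -> continuous (theta \o f).
  move=> fc s; have cl (u : R) : {for s, continuous (fun x => clamp (2 * f x + u))}.
    apply: (@continuous_comp _ _ _ (fun x => 2 * f x + u) clamp).
      by apply: ctsD; [apply: ctsM; [apply: cts_cst | apply: fc] | apply: cts_cst].
    exact: clamp_continuous.
  apply: (@ctsD _ s (fun x => a + (b - a) * clamp (2 * f x + 0))
    (fun x => (c - b) * clamp (2 * f x + - 1))).
    apply: ctsD; first exact: cts_cst.
    by apply: ctsM; [apply: cts_cst | apply: cl].
  by apply: ctsM; [apply: cts_cst | apply: cl].
pose h (p : R * R) := (1 + - 1 * p.1) * theta p.2 + p.1 * (a + (c - a) * p.2).
have hc : continuous h.
  move=> p; have f1 : {for p, continuous (fun p : R * R => p.1)} by apply: cvg_fst.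
  have f2 : {for p, continuous (fun p : R * R => p.2)} by apply: cvg_snd.
  apply: (@ctsD _ p (fun p => (1 + - 1 * p.1) * theta p.2)
    (fun p => p.1 * (a + (c - a) * p.2))).
    apply: ctsM; last by apply: thetac => q; apply: cvg_snd.
    by apply: ctsD; [apply: cts_cst | apply: ctsM => //; apply: cts_cst].
  apply: ctsM => //; apply: ctsD; first exact: cts_cst.
  by apply: ctsM => //; apply: cts_cst.
apply/esym/(@phi_homotopic _ _ phiH _ _ (g \o clamp \o h)).
- by apply: concat_loop; apply: piece_loop.
- exact: piece_loop.
- move=> p; apply: (@continuous_comp _ _ _ h (g \o clamp)); first exact: hc.
  exact: (loop_continuous gL).
- by move=> p; apply: loop_earring.
- move=> t /andP[t0 t1]; rewrite /h /theta /loop_concat /piece /=; split; last first.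
    by congr (g (clamp _)); ring.
  case: leP => t2; congr (g (clamp _)).
    rewrite (clamp_id (t := 2 * t + 0)); last by rewrite /I01 /=; lra.
    by rewrite (clamp_le0 (t := 2 * t + - 1)); [ring | lra].
  rewrite (clamp_ge1 (t := 2 * t + 0)); last by lra.
  by rewrite (clamp_id (t := 2 * t + - 1)); [ring | rewrite /I01 /=; lra].
- move=> s; rewrite /h /theta /=; split.
    rewrite (clamp_le0 (t := 2 * 0 + 0)); last by lra.
    rewrite (clamp_le0 (t := 2 * 0 + - 1)); last by lra.
    by rewrite -[RHS]ga; congr (g (clamp _)); ring.
  rewrite (clamp_ge1 (t := 2 * 1 + 0)); last by lra.
  rewrite (clamp_ge1 (t := 2 * 1 + - 1)); last by lra.
  by rewrite -[RHS]gc; congr (g (clamp _)); ring.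
Qed.

Variable N : nat.
Hypothesis phi_tail : forall g, tail_loop N g -> phi g = gone G.

Lemma phi_run g a b : is_loop g -> 0 <= a -> a <= b -> b <= 1 ->
  g a = base -> g b = base ->
  (forall t, a <= t <= b -> head N (g t)) \/ (forall t, a <= t <= b -> tail N (g t)) ->
  phi (piece g a b) = phi (piece (retr N \o g) a b).
Proof.
move=> gL a0 ab b1 ga gb run.
have gca : g (clamp a) = base by rewrite clamp_id // /I01 /=; lra.
have gcb : g (clamp b) = base by rewrite clamp_id // /I01 /=; lra.
have pL : is_loop (piece g a b) by apply: piece_loop.
have inab t : I01 t -> a <= clamp (a + (b - a) * t) <= b.
  by move=> /andP[t0 t1]; rewrite clamp_id; [nra | rewrite /I01 /=; nra].
case: run => run.
  by apply: (phi_eq phiH) => // t It; rewrite /piece /= retr_head //; apply/run/inab.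
rewrite phi_tail; last by split=> // t It; apply/run/inab.
rewrite -(phi_const phiH); apply: (phi_eq phiH); first by case: (const_loop 0).
by move=> t It; rewrite /piece /= retr_tail //; apply/run/inab.
Qed.

Lemma phi_grid g (M : nat) : is_loop g -> (0 < M)%N ->
  (forall j, (j < M)%N ->
    (forall t, j%:R / M%:R <= t <= j.+1%:R / M%:R -> head N (g t)) \/
    (forall t, j%:R / M%:R <= t <= j.+1%:R / M%:R -> tail N (g t))) ->
  phi g = phi (retr N \o g).
Proof.
move=> gL M0 cells; pose c (j : nat) : R := j%:R / M%:R.
have M0' : 0 < M%:R :> R by rewrite ltr0n.
have c_le i j : (i <= j)%N -> c i <= c j by move=> ij; rewrite ler_pM2r ?invr_gt0 ?ler_nat.
have c0 : c 0%N = 0 by rewrite /c mul0r.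
have cM : c M = 1 by rewrite /c divff // lt0r_neq0.
have c_ge0 j : 0 <= c j by rewrite -c0; apply: c_le.
have [_ [_ [g0 g1]]] := gL; have rL := retr_loop N gL.
have gI t : I01 t -> g (clamp t) = g t by move=> /clamp_id ->.
have cI j : (j <= M)%N -> I01 (c j) by move=> jM; rewrite /I01 /= c_ge0 -cM c_le.
pose good a b := phi (piece g a b) = phi (piece (retr N \o g) a b).
have base_c i : (i <= M)%N -> g (c i) = base ->
    g (clamp (c i)) = base /\ (retr N \o g) (clamp (c i)) = base.
  move=> iM gi; have e : g (clamp (c i)) = base by rewrite gI //; apply: cI.
  by rewrite /= e retr_base.
have [g0' r0] : g (clamp 0) = base /\ (retr N \o g) (clamp 0) = base.
  by have := base_c 0%N (leq0n M); rewrite c0; apply.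
have good_trans i j : (i <= M)%N -> (j <= M)%N -> g (c i) = base -> g (c j) = base ->
    good 0 (c i) -> good (c i) (c j) -> good 0 (c j).
  move=> iM jM /(base_c i iM)[gi ri] /(base_c j jM)[gj rj] e e'.
  by rewrite /good (phi_piece gL g0' gi gj) e e' -(phi_piece rL r0 ri rj).
have good_run i j : (i <= j)%N -> (j <= M)%N -> g (c i) = base -> g (c j) = base ->
    (forall t, c i <= t <= c j -> head N (g t)) \/
    (forall t, c i <= t <= c j -> tail N (g t)) -> good (c i) (c j).
  by move=> ij jM gi gj; apply: phi_run => //; [apply: c_le | rewrite -cM c_le].
(* Sweep over the grid: up to [c i] the claim is settled, and from [c i] to the current grid point
   there is one open run. When the type of the cells changes, the grid point is in [head] and
   [tail], hence mapped to the base point, and the run can be closed. *)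
have [i [iM gi e run]] : exists i, [/\ (i <= M)%N, g (c i) = base, good 0 (c i) &
    (forall t, c i <= t <= c M -> head N (g t)) \/
    (forall t, c i <= t <= c M -> tail N (g t))].
  have : (M <= M)%N by []; elim: {1 3 4 5}M => [_|j IH jM].
    have t0 : forall t, c 0%N <= t <= c 0%N -> tail N (g t).
      by move=> t; rewrite c0 -eq_le => /eqP <-; rewrite g0; apply: tail_base.
    exists 0%N; rewrite c0; split=> //; last by right; rewrite -{1 2}c0.
    by apply: phi_run; rewrite ?lexx ?ler01 //; right; rewrite -{1 2}c0.
  have [i [ij gi e run]] := IH (ltnW jM).
  have cell := cells j jM.
  have c_split t : c i <= t <= c j.+1 -> (c i <= t <= c j) || (c j <= t <= c j.+1).
    by move=> /andP[it tj]; case: (leP t (c j)) => tcj; rewrite it /= ?tj ?ltW ?orbT.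
  have cjj : c j <= c j <= c j.+1 by rewrite lexx c_le.
  have cij : c i <= c j <= c j by rewrite lexx c_le.
  have switch : g (c j) = base -> exists i, [/\ (i <= j.+1)%N, g (c i) = base, good 0 (c i) &
      (forall t, c i <= t <= c j.+1 -> head N (g t)) \/
      (forall t, c i <= t <= c j.+1 -> tail N (g t))].
    move=> gj; exists j; split=> //.
    by apply: (good_trans i) => //; [lia | exact: ltnW | apply: good_run => //; exact: ltnW].
  case: run => run; case: cell => cell.
  - by exists i; split=> //; [exact: leqW | left=> t /c_split/orP[/run|/cell]].
  - by apply: switch; apply: head_tail (run _ cij) (cell _ cjj).
  - by apply: switch; apply: head_tail (cell _ cjj) (run _ cij).
  - by exists i; split=> //; [exact: leqW | right=> t /c_split/orP[/run|/cell]].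
have whole h : is_loop h -> phi h = phi (piece h 0 (c M)).
  move=> hL; apply: (phi_eq phiH) => // t It.
  by rewrite /piece cM add0r subr0 mul1r clamp_id.
rewrite whole // [RHS]whole //; apply: (good_trans i) => //; first by rewrite cM.
by apply: good_run => //; rewrite cM.
Qed.

Lemma phi_retr g : is_loop g -> phi g = phi (retr N \o g).
Proof.
move=> gL; have gc := loop_continuous gL; have gE := loop_earring gL.
pose g1 t := contract 1 (g (clamp t)).
(* The absolute value keeps the parameter non-negative on the whole plane, as [contract_continuous]
   demands. *)
pose h (p : R * R) := contract `|p.1| (g (clamp p.2)).
have hc : continuous h.
  apply: (@contract_continuous _ (fun p : R * R => `|p.1|) (fun p => g (clamp p.2))).
  - by move=> p; apply: cts_norm; apply: cvg_fst.
  - move=> p; apply: (@continuous_comp _ _ _ snd (g \o clamp)); last exact: gc.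
    exact: cvg_snd.
  - by move=> p; apply: normr_ge0.
have hE p : earring (h p) by apply/contract_earring/gE.
have h0 t : I01 t -> h (0, t) = g t by move=> It; rewrite /h /= normr0 contract0 clamp_id.
have h1 t : h (1, t) = g1 t by rewrite /h /= normr1.
have hs s : h (s, 0) = base /\ h (s, 1) = base.
  by rewrite /h /= (loop_le0 gL) // (loop_ge1 gL) // contract_base.
have g1L : is_loop g1.
  apply: (@loop_intro _ g1) => // [|t It||].
  - have -> : g1 = h \o (fun t => (1, t)) by apply/funext => t; rewrite /= h1.
    move=> t; apply: (@continuous_comp _ _ _ (fun t : R => (1 : R, t)) h).
      by apply: cts_pair; [apply: cts_cst | apply: cvg_id].
    exact: hc.
  - by rewrite -h1; apply: hE.
  - by rewrite -h1; case: (hs 1).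
  - by rewrite -h1; case: (hs 1).
rewrite (@phi_homotopic _ _ phiH g g1 h) //; last by move=> t It; rewrite h0 // h1.
rewrite [RHS](@phi_homotopic _ _ phiH _ (retr N \o g1) (retr N \o h)); last 6 first.
- exact: retr_loop.
- exact: retr_loop.
- exact: retr_continuous.
- by move=> p; apply: retr_earring.
- by move=> t It; rewrite /= h0 // h1.
- by move=> s; have [e0 e1] := hs s; rewrite /= e0 e1 retr_base.
have sepc : continuous (sep N \o (g \o clamp)) by move=> t; apply: cts_sep; apply: gc.
have [M M0 unif] := uniformly_continuous_I01 sepc (gap_gt0 N).
have M0' : 0 < M%:R :> R by rewrite ltr0n.
apply: (phi_grid g1L M0) => j jM.
have inI t : j%:R / M%:R <= t <= j.+1%:R / M%:R -> I01 t.
  move=> /andP[jt tj]; rewrite /I01 /= (le_trans _ jt) ?divr_ge0 //=.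
  by rewrite (le_trans tj) // ler_pdivrMr // mul1r ler_nat.
(* If [sep] reaches [gap] somewhere in the cell, uniform continuity keeps it positive on the whole
   cell, which lies in the large circles; otherwise every point of the cell on a large circle is
   flattened. *)
have [[t tj far]|near] := pselect (exists2 t, j%:R / M%:R <= t <= j.+1%:R / M%:R &
    gap N <= sep N (g (clamp t))).
  left=> u uj; have [n /= nN un] : head N (g (clamp u)).
    apply: sep_gt0_head => //; have := unif t u (inI _ tj) (inI _ uj).
    have -> : `|t - u| <= M%:R^-1.
      have e : j.+1%:R / M%:R = j%:R / M%:R + M%:R^-1 :> R.
        by rewrite -addn1 natrD mulrDl mul1r.
      by move: tj uj; rewrite e ler_norml; lra.
    by move=> /(_ isT); rewrite ltr_norml /=; lra.
  by exists n => //; apply: contract_circle.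
right=> u uj; have [n _ un] := gE u.
case: (ltnP n N) => nN; last by exists n => //; apply: contract_circle.
suff -> : g1 u = base by apply: tail_base.
apply: contrapT => ne; apply: near; exists u => //; exact: contract1_far un nN ne.
Qed.

End Decomposition.

(** * The class of n-slender groups *)

Lemma n_slender_graph_product (V : Type) (adj : V -> V -> Prop) (Gv : V -> group)
    (P : group) (iota : forall v, Gv v -> P) :
  simple_graph adj -> is_graph_product adj iota ->
  (forall v, n_slender (Gv v)) -> n_slender P.
Proof.
move=> graphV prodP sG phi phiH.
suff [U [N ->] kill] : exists2 U, [set U | exists N, U = tail_loop N] U &
    forall g, U g -> phi g = gone P by exists N; apply: phi_retr.
apply: (@near_trivial _ _ _ _ _ graphV prodP).
- move=> _ _ [m ->] [n ->]; exists (tail_loop (maxn m n)); first by exists (maxn m n).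
  by move=> g gT; split; apply: tail_loopW gT; [apply: leq_maxl | apply: leq_maxr].
- by exists (tail_loop 0), 0%N.
- exact: hawaii_solvable.
move=> v; have rM := @projM _ _ _ _ _ graphV prodP v.
have [|N phiN] := sG v (vproj graphV prodP v \o phi).
  split=> [g h gL hL gh|g h gL hL] /=; first by rewrite (phiH.1 g h).
  by rewrite phiH.2.
exists (tail_loop N); first by exists N.
move=> g [gL gT]; have /= -> := phiN g gL.
rewrite -(@phi_eq _ _ phiH (fun=> base)) ?(phi_const phiH) ?(hom1 rM) //.
  by case: (const_loop 0).
by move=> t It /=; rewrite retr_tail //; apply: gT.
Qed.

Theorem theorem3p3 (V : Type) (adj : V -> V -> Prop) (Gv : V -> group)
  (P : group) (iota : forall v, Gv v -> P) :
  @simple_graph V adj -> @is_graph_product V adj Gv P iota ->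
  ((forall v, n_slender (Gv v)) -> n_slender P) /\
  ((forall v, cm_slender (Gv v)) -> cm_slender P) /\
  ((forall v, lcH_slender (Gv v)) -> lcH_slender P).
Proof.
move=> graphV prodP; split; first exact: n_slender_graph_product graphV prodP.
split; first exact: cm_slender_graph_product graphV prodP.
exact: lcH_slender_graph_product graphV prodP.
Qed.
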